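(* Let $\Phi\in L^\infty_{M_n}$ be a matrix-valued rational function, so that one may write $$\Phi_-=B^*\Theta,$$ where $B\in H^2_{M_n}$ and $\Theta:=\theta I_n$ with a finite Blaschke product $\theta$. Suppose $B$ and $\Theta$ are coprime. If both $T_\Phi$ and $T_\Phi^2$ are hyponormal, then $T_\Phi$ is either normal or analytic.
   Context: $H^2$ is the Hardy space of the unit circle $\mathbb T$; $L^p_{M_n}$, $H^p_{M_n}$, $L^2_{\mathbb C^n}$, $H^2_{\mathbb C^n}$ are the matrix/vector-valued versions. $P_n$ is the orthogonal projection of $L^2_{\mathbb C^n}$ onto $H^2_{\mathbb C^n}$ (also used entrywise on matrix functions), $P_n^\perp=I-P_n$. For $\Phi\in L^\infty_{M_n}$, $T_\Phi f:=P_n(\Phi f)$ on $H^2_{\mathbb C^n}$; $\Phi_+:=P_n(\Phi)\in H^2_{M_n}$, $\Phi_-:=[P_n^\perp(\Phi)]^*\in H^2_{M_n}$, so $\Phi=\Phi_-^*+\Phi_+$. $\Phi$ is rational if each entry is a rational function. An operator $T$ is normal if $T^*T-TT^*=0$ and hyponormal if $T^*T-TT^*\ge0$. $T_\Phi$ is called analytic if $\Phi\in H^\infty_{M_n}$. An inner matrix function is $\Delta\in H^\infty_{M_{n\times m}}$ with $\Delta^*\Delta=I_m$ a.e. on $\mathbb T$. $\Delta\in H^2_{M_{n\times m}}$ is a left inner divisor of $F\in H^2_{M_n}$ if $\Delta$ is inner and $F=\Delta G$ for some $G\in H^2_{M_{m\times n}}$. $F,G\in H^2_{M_n}$ are left coprime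 if their only common left inner divisors are unitary constants; they are right coprime if $\widetilde F,\widetilde G$ are left coprime, where $\widetilde F(z):=F^*(\overline z)$; they are coprime if they are both left and right coprime. *)

(* Defs.v *)
From HB Require Import structures.
From mathcomp Require Import all_boot all_order all_algebra.
From mathcomp Require Import all_classical all_reals all_analysis.
From mathcomp Require Import complex.

Set Implicit Arguments.
Unset Strict Implicit.
Unset Printing Implicit Defensive.

Import Order.TTheory GRing.Theory Num.Theory.

Local Open Scope classical_set_scope.
Local Open Scope ring_scope.
Local Open Scope complex_scope.
Local Open Scope sesquilinear_scope.

(* An element of L^p(T) is represented by a function on R[i] of which only the
   values on the circle matter, Borel measurable as a function of the angle;
   equalities between such functions are required almost everywhere. *)

Section Circle.
Context {R : realType}.
Local Notation C := R[i].

Lemma twopi_gt0 : 0 < 2 * pi :> R.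
Proof. by rewrite mulr_gt0 ?pi_gt0. Qed.

Definition cis (t : R) : C := cos t +i* sin t.

(* Normalized Lebesgue measure dt / (2 pi) on [0, 2 pi]. *)
Definition circle : probability (measurableTypeR R) R :=
  uniform_prob twopi_gt0.

Definition aeT (P : C -> Prop) : Prop := {ae circle, forall t, P (cis t)}.

Definition integralT (f : C -> C) : C :=
  (\int[circle]_t complex.Re (f (cis t))) +i*
  (\int[circle]_t complex.Im (f (cis t))).

Definition Lp (p : \bar R) (f : C -> C) : Prop :=
  [/\ measurable_fun setT (fun t : measurableTypeR R => complex.Re (f (cis t))),
      measurable_fun setT (fun t : measurableTypeR R => complex.Im (f (cis t)))
    & (Lnorm circle p (fun t => (Normc.normc (f (cis t)))%:E) < +oo)%E].

(* The integral is the Fourier coefficient of f of index - (k + 1). *)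
Definition Hp (p : \bar R) (f : C -> C) : Prop :=
  Lp p f /\ forall k : nat, integralT (fun z => f z * z ^+ k.+1) = 0.

Definition mxLp (p : \bar R) m n (F : C -> 'M[C]_(m, n)) : Prop :=
  forall i j, Lp p (fun z => F z i j).

Definition mxHp (p : \bar R) m n (F : C -> 'M[C]_(m, n)) : Prop :=
  forall i j, Hp p (fun z => F z i j).

Definition inner n (f g : C -> 'cV[C]_n) : C :=
  integralT (fun z => \sum_(i < n) f z i 0 * (g z i 0)^*).

(* Orthogonal projection of L^2_{C^n} onto H^2_{C^n}: a chosen representative
   of the class of the h in H^2 such that f - h is orthogonal to H^2. *)
Definition Pn n (f : C -> 'cV[C]_n) : C -> 'cV[C]_n :=
  xget (fun=> 0) [set h | mxHp 2%:E h /\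
    forall g, mxHp 2%:E g -> inner (fun z => f z - h z) g = 0].

Definition P1 (f : C -> C) : C -> C :=
  fun z => Pn (fun w => (f w)%:M : 'cV[C]_1) z 0 0.

Definition Pmx m n (F : C -> 'M[C]_(m, n)) : C -> 'M[C]_(m, n) :=
  fun z => \matrix_(i, j) P1 (fun w => F w i j) z.

Definition Toeplitz n (Phi : C -> 'M[C]_n) (f : C -> 'cV[C]_n) :
  C -> 'cV[C]_n := Pn (fun z => Phi z *m f z).

Definition minus_part n (Phi : C -> 'M[C]_n) : C -> 'M[C]_n :=
  fun z => (Phi z - Pmx Phi z)^t*.

(* T^*: chosen, like Pn, as a representative of the a.e. class that the
   defining relation determines. *)
Definition adjoint n (T : (C -> 'cV[C]_n) -> (C -> 'cV[C]_n))
    (g : C -> 'cV[C]_n) : C -> 'cV[C]_n :=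
  xget (fun=> 0) [set h | mxHp 2%:E h /\
    forall f, mxHp 2%:E f -> inner (T f) g = inner f h].

Definition self_commutator n (T : (C -> 'cV[C]_n) -> (C -> 'cV[C]_n))
    (f : C -> 'cV[C]_n) : C -> 'cV[C]_n :=
  fun z => adjoint T (T f) z - T (adjoint T f) z.

Definition normal_op n (T : (C -> 'cV[C]_n) -> (C -> 'cV[C]_n)) : Prop :=
  forall f, mxHp 2%:E f -> aeT (fun z => self_commutator T f z = 0).

(* In R[i], 0 <= x means that x is real and nonnegative. *)
Definition hyponormal n (T : (C -> 'cV[C]_n) -> (C -> 'cV[C]_n)) : Prop :=
  forall f, mxHp 2%:E f -> 0 <= inner (self_commutator T f) f.

Definition rational_mx m n (F : C -> 'M[C]_(m, n)) : Prop :=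
  forall i j, exists p q : {poly C},
    q != 0 /\ aeT (fun z => F z i j = p.[z] / q.[z]).

Definition finite_blaschke (theta : C -> C) : Prop :=
  exists (c : C) (s : seq C),
    [/\ `|c| = 1, {in s, forall a, `|a| < 1}
      & aeT (fun z =>
          theta z = c * \prod_(a <- s) ((z - a) / (1 - a^* * z)))].

Definition inner_mx n m (D : C -> 'M[C]_(n, m)) : Prop :=
  mxHp +oo%E D /\ aeT (fun z => (D z)^t* *m D z = 1%:M).

Definition left_inner_divisor n m k (D : C -> 'M[C]_(n, m))
    (F : C -> 'M[C]_(n, k)) : Prop :=
  inner_mx D /\ exists2 G : C -> 'M[C]_(m, k),
    mxHp 2%:E G & aeT (fun z => F z = D z *m G z).

(* The two equations force m = n. *)
Definition unitary_constant n m (D : C -> 'M[C]_(n, m)) : Prop :=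
  exists U : 'M[C]_(n, m),
    [/\ U^t* *m U = 1%:M, U *m U^t* = 1%:M & aeT (fun z => D z = U)].

Definition left_coprime n (F G : C -> 'M[C]_n) : Prop :=
  forall m (D : C -> 'M[C]_(n, m)),
    left_inner_divisor D F -> left_inner_divisor D G -> unitary_constant D.

Definition tilde m n (F : C -> 'M[C]_(m, n)) : C -> 'M[C]_(n, m) :=
  fun z => (F z^*)^t*.

Definition right_coprime n (F G : C -> 'M[C]_n) : Prop :=
  left_coprime (tilde F) (tilde G).

Definition coprime_mx n (F G : C -> 'M[C]_n) : Prop :=
  left_coprime F G /\ right_coprime F G.

End Circle.

(* Main.v *)
(**
Write T for the Toeplitz operator of Phi, Psi for the pointwise adjoint of Phi
(so that T^* is the Toeplitz operator of Psi), and
D(f, g) = <T f, T g> - <T^* f, T^* g>, a nonnegative form by hyponormality.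

Phi is normal almost everywhere: on multiples of a common denominator of Phi
and Psi, D is given by the pointwise commutator, which has trace zero, so D
vanishes there. Consequently, if f, Psi f and Psi^2 f lie in H^2, then
T^2 f = Phi^2 f and T^{*2} f = Psi^2 f have equal norms, and Cauchy-Schwarz for
the form of T^2 puts u = Phi Psi f in the kernel of D.

Let a be a zero of theta, of multiplicity t. Coprimeness makes the leading
coefficient of the pole of Phi at a, of order t, invertible. The inclusions
above, compared at a, show that Psi has a pole of order at most t there. Hence u
can be chosen, columnwise in a matrix, so that Phi u and Psi u have simple poles
at a with residues A2 and A1, where A2 is invertible. Then D(u, g) = 0 for all g
reads P^perp (A2^* Phi g - A1^* Psi g) = 0, while testing on g = u gives
A2^* A2 = A1^* A1. So P^perp Psi g is a unitary matrix times P^perp Phi g, hence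
D = 0 and T is normal. If theta has no zeros, Phi is analytic.
*)

Require Import Defs.
From HB Require Import structures.
From mathcomp Require Import all_boot all_order all_algebra.
From mathcomp Require Import all_classical all_reals all_analysis.
From mathcomp Require Import ring lra zify.
From mathcomp Require Import measurable_realfun ess_sup_inf complex.
Set Implicit Arguments.
Unset Strict Implicit.
Unset Printing Implicit Defensive.
Import Order.TTheory GRing.Theory Num.Theory.
Import numFieldNormedType.Exports.
Local Open Scope classical_set_scope.
Local Open Scope ring_scope.
Local Open Scope complex_scope.
Local Open Scope sesquilinear_scope.

(** [Pn] and [adjoint] choose a witness and fall back on 0, so nothing is known of [Toeplitz Phi]
    until projections are exhibited. For a bounded rational symbol they are computed: division by
    [z - a] preserves H^2 if |a| > 1, costs a multiple of [(z - a)^-1], orthogonal to H^2, if |a| <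
    1, and boundedness excludes |a| = 1. [Phi] and its adjoint are then polynomial matrices over a
    denominator without zeros on the circle, and holomorphy at [a] becomes divisibility by powers of
    ['X - a%:P]. The inclusions are two: [Psi f] in H^2 forces [Phi f] in H^2, and for u in the
    kernel of D, [Phi u] in H^2 forces [Psi u] in H^2. Both hold because a function whose projection
    loses no norm lies in H^2. The first makes the inverse of [Psi] vanish to order at least t at
    [a], which supplies enough f; the second lowers the pole of [Psi] to order t. The simple poles
    come from u = Phi G, with G scalar of order 2t - 1 at [a], since Phi^2 and Psi Phi have poles of
    order at most 2t. A single zero [a] is enough: replacing g by z^k g in D(u, g) = 0 reaches every
    negative Fourier coefficient. *)

Section CircleFunctions.
Context {R : realType}.
Local Notation C := R[i].
Local Notation Re := (@complex.Re R).
Local Notation Im := (@complex.Im R).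
Implicit Types f g h : C -> C.

(** * Measurability and integrability on the circle *)

Lemma ReD (x y : C) : Re (x + y) = Re x + Re y. Proof. by case: x; case: y. Qed.

Lemma ImD (x y : C) : Im (x + y) = Im x + Im y. Proof. by case: x; case: y. Qed.

Lemma ReM (x y : C) : Re (x * y) = Re x * Re y - Im x * Im y.
Proof. by case: x; case: y. Qed.

Lemma ImM (x y : C) : Im (x * y) = Re x * Im y + Im x * Re y.
Proof. by case: x; case: y. Qed.

Lemma ReJ (x : C) : Re (x^*)%R = Re x. Proof. by case: x. Qed.

Lemma ImJ (x : C) : Im (x^*)%R = - Im x. Proof. by case: x. Qed.

(* A function on C is only considered through its values on the unit circle. *)
Definition cmeas f :=
  measurable_fun setT (fun t : measurableTypeR R => Re (f (cis t))) /\
  measurable_fun setT (fun t : measurableTypeR R => Im (f (cis t))).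

Lemma cmeas_cst (c : C) : cmeas (fun=> c).
Proof. by split; apply: measurable_cst. Qed.

Lemma cmeas_id : cmeas id.
Proof.
by split; apply: continuous_measurable_fun;
  [exact: continuous_cos | exact: continuous_sin].
Qed.

Lemma cmeasD f g : cmeas f -> cmeas g -> cmeas (fun z => f z + g z).
Proof.
move=> [f1 f2] [g1 g2]; split.
- under eq_fun do rewrite ReD; exact: measurable_funD.
- under eq_fun do rewrite ImD; exact: measurable_funD.
Qed.

Lemma cmeasM f g : cmeas f -> cmeas g -> cmeas (fun z => f z * g z).
Proof.
move=> [f1 f2] [g1 g2]; split.
- under eq_fun do rewrite ReM.
  by apply: measurable_funB;
    apply: measurable_funM.
- under eq_fun do rewrite ImM.
  by apply: measurable_funD;
    apply: measurable_funM.
Qed.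

Lemma cmeasJ f : cmeas f -> cmeas (fun z => (f z)^*%R).
Proof.
move=> [f1 f2]; split.
- by under eq_fun do rewrite ReJ.
- under eq_fun do rewrite ImJ; exact: measurable_funN.
Qed.

Local Notation mu := (@circle R).
Lemma aeTS (P Q : C -> Prop) : (forall t, P (cis t) -> Q (cis t)) -> aeT P -> aeT Q.
Proof.
by move=> h k; apply: (@filterS _ _ (ae_filter_ringOfSetsType mu)) k => t; exact: h.
Qed.

Lemma aeTI (P Q : C -> Prop) : aeT P -> aeT Q -> aeT (fun z => P z /\ Q z).
Proof. exact: (@filterI _ _ (ae_filter_ringOfSetsType mu)). Qed.

Lemma ae_aeT (u v : R -> \bar R) (P : C -> Prop) : aeT P ->
  (forall t, P (cis t) -> u t = v t) -> ae_eq mu setT u v.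
Proof.
move=> h k; apply: (@filterS _ _ (ae_filter_ringOfSetsType mu)) h => t /= Pt _.
exact: k.
Qed.

Definition rint (u : R -> R) :=
  mu.-integrable setT (EFin \o (u : measurableTypeR R -> R)).

Definition cintg f := rint (fun t => Re (f (cis t))) /\ rint (fun t => Im (f (cis t))).

Lemma rintD u v : rint u -> rint v -> rint (fun t => u t + v t).
Proof. by move=> hu hv; exact: (integrableD measurableT hu hv). Qed.

Lemma rintZ a u : rint u -> rint (fun t => a * u t).
Proof. by move=> hu; exact: (integrableZl measurableT a hu). Qed.

Lemma rint_le u v : measurable_fun setT (u : measurableTypeR R -> R) -> rint v ->
  (forall t, `|u t| <= v t) -> rint u.
Proof.
move=> mu hv huv; apply: (le_integrable measurableT _ _ hv).
  exact/measurable_EFinP.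
move=> t _ /=; rewrite lee_fin; apply: le_trans (huv t) _; exact: ler_norm.
Qed.

Lemma cintg_meas f : cintg f -> cmeas f.
Proof.
by move=> [/integrableP[h1 _] /integrableP[h2 _]]; split;
  apply/measurable_EFinP.
Qed.

Lemma cintgD f g : cintg f -> cintg g -> cintg (fun z => f z + g z).
Proof.
move=> [f1 f2] [g1 g2]; split.
- under eq_fun do rewrite ReD; exact: rintD.
- under eq_fun do rewrite ImD; exact: rintD.
Qed.

Lemma cintgZ c f : cintg f -> cintg (fun z => c * f z).
Proof.
move=> [f1 f2]; split.
- under eq_fun do rewrite ReM -mulNr.
  by apply: rintD; apply: rintZ.
- under eq_fun do rewrite ImM.
  by apply: rintD; apply: rintZ.
Qed.

Lemma cintgJ f : cintg f -> cintg (fun z => (f z)^*%R).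
Proof.
move=> [f1 f2]; split.
- by under eq_fun do rewrite ReJ.
- under eq_fun do rewrite ImJ -mulN1r; exact: rintZ.
Qed.

Lemma integralTD f g : cintg f -> cintg g ->
  integralT (fun z => f z + g z) = integralT f + integralT g.
Proof.
move=> [f1 f2] [g1 g2]; rewrite /integralT.
under eq_Rintegral do rewrite ReD.
under [X in _ +i* X = _]eq_Rintegral do rewrite ImD.
by rewrite !RintegralD.
Qed.

Lemma integralTZ c f : cintg f -> integralT (fun z => c * f z) = c * integralT f.
Proof.
move=> [f1 f2]; rewrite /integralT.
under eq_Rintegral do rewrite ReM.
under [X in _ +i* X = _]eq_Rintegral do rewrite ImM.
rewrite RintegralB ?RintegralD ?RintegralZl //; try exact: rintZ.
by case: c.
Qed.

Lemma integralTJ f : cintg f -> integralT (fun z => (f z)^*%R) = (integralT f)^*%R.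
Proof.
move=> [f1 f2]; rewrite /integralT.
under eq_Rintegral do rewrite ReJ.
under [X in _ +i* X = _]eq_Rintegral do rewrite ImJ -mulN1r.
by rewrite RintegralZl // mulN1r.
Qed.

Lemma integralT_ae f g : cmeas f -> cmeas g -> aeT (fun z => f z = g z) ->
  integralT f = integralT g.
Proof.
move=> [f1 f2] [g1 g2] fg; rewrite /integralT /Rintegral; congr (fine _ +i* fine _).
- apply: ae_eq_integral => //; try exact/measurable_EFinP.
  by apply: (ae_aeT fg) => t /= ->.
- apply: ae_eq_integral => //; try exact/measurable_EFinP.
  by apply: (ae_aeT fg) => t /= ->.
Qed.

Lemma rint_ae u v (P : C -> Prop) : rint u ->
  measurable_fun setT (v : measurableTypeR R -> R) ->
  aeT P -> (forall t, P (cis t) -> u t = v t) -> rint v.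
Proof.
move=> /integrableP[mu1 u2] /measurable_EFinP mv hP h.
apply/integrableP; split=> //; move: u2; apply: le_lt_trans.
rewrite le_eqVlt; apply/orP; left; apply/eqP.
apply: ae_eq_integral => //; [exact: measurableT_comp | exact: measurableT_comp |].
by apply: (ae_aeT hP) => t /= /h ->.
Qed.

Local Notation normc := Normc.normc.
Lemma normcE2 (x : C) : normc x ^+ 2 = Re x ^+ 2 + Im x ^+ 2.
Proof. by case: x => a b /=; rewrite sqr_sqrtr // addr_ge0 ?sqr_ge0. Qed.

Lemma Re_le_normc (x : C) : `|Re x| <= normc x.
Proof.
rewrite -(@ler_pXn2r _ 2) ?nnegrE ?sqrtr_ge0 //; last by case: x => a b; exact: sqrtr_ge0.
by rewrite normcE2 real_normK ?num_real // lerDl sqr_ge0.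
Qed.

Lemma Im_le_normc (x : C) : `|Im x| <= normc x.
Proof.
rewrite -(@ler_pXn2r _ 2) ?nnegrE ?sqrtr_ge0 //; last by case: x => a b; exact: sqrtr_ge0.
by rewrite normcE2 real_normK ?num_real // lerDr sqr_ge0.
Qed.

Lemma cintg_le f v : cmeas f -> rint v -> (forall t, normc (f (cis t)) <= v t) -> cintg f.
Proof.
move=> [f1 f2] hv h; split; apply: (rint_le _ hv) => // t.
- exact: le_trans (Re_le_normc _) (h t).
- exact: le_trans (Im_le_normc _) (h t).
Qed.

Lemma meas_normc2 f : cmeas f ->
  measurable_fun setT (fun t : measurableTypeR R => normc (f (cis t)) ^+ 2).
Proof.
move=> [f1 f2]; under eq_fun do rewrite normcE2.
by apply: measurable_funD; apply: measurable_funX.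
Qed.

Lemma Lp2P f : Lp 2%:E f <-> cmeas f /\ rint (fun t => normc (f (cis t)) ^+ 2).
Proof.
have E : (\int[mu]_t (`|(normc (f (cis t)))%:E| `^ 2) =
          \int[mu]_t `|(normc (f (cis t)) ^+ 2)%:E|)%E.
  apply: eq_integral => t _ /=.
  by rewrite powR_mulrn // normrX.
split=> [[f1 f2 f3]|[[f1 f2] f3]].
- split=> //; apply/integrableP; split.
    by apply/measurable_EFinP; apply: meas_normc2; split.
  move: f3; rewrite Lnorm.unlock => /lty_poweRy; rewrite invr_eq0 pnatr_eq0 => /(_ isT).
  by rewrite E.
- split=> //; rewrite Lnorm.unlock; apply: poweR_lty.
  by rewrite E; case/integrableP : f3.
Qed.
End CircleFunctions.

(** * Square integrable and essentially bounded functions *)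

Section SquareIntegrable.
Context {R : realType}.
Local Notation C := R[i].
Local Notation Re := (@complex.Re R).
Local Notation Im := (@complex.Im R).
Local Notation mu := (@circle R).
Local Notation normc := Normc.normc.
Implicit Types f g h b : C -> C.

Lemma normc_ge0 (x : C) : 0 <= normc x.
Proof. by case: x => a b; exact: sqrtr_ge0. Qed.

Lemma normcD_sqr (x y : C) : normc (x + y) ^+ 2 <= 2 * (normc x ^+ 2 + normc y ^+ 2).
Proof.
rewrite !normcE2 ReD ImD.
have sq (a c : R) : (a + c) ^+ 2 <= 2 * (a ^+ 2 + c ^+ 2).
  by rewrite -subr_ge0 (_ : _ - _ = (a - c) ^+ 2) ?sqr_ge0 //; ring.
by rewrite addrACA mulrDr lerD.
Qed.

Lemma normcM_le (x y : C) : normc (x * y) <= normc x ^+ 2 + normc y ^+ 2.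
Proof.
rewrite Normc.normcM.
have := sqr_ge0 (normc x - normc y); have := sqr_ge0 (normc x + normc y).
nra.
Qed.

Lemma normcJ (x : C) : normc (x^*)%R = normc x.
Proof. by case: x => a b /=; rewrite sqrrN. Qed.

Lemma normc_mulJ (x : C) : x * (x^*)%R = (normc x ^+ 2)%:C.
Proof. by rewrite normcE2; case: x => a b; apply/eqP; rewrite eq_complex /=; apply/andP; split; apply/eqP; ring. Qed.

Lemma Lp2_meas f : Lp 2%:E f -> cmeas f. Proof. by move/Lp2P => []. Qed.

Lemma Lp2D f g : Lp 2%:E f -> Lp 2%:E g -> Lp 2%:E (fun z => f z + g z).
Proof.
move=> /Lp2P[f1 f2] /Lp2P[g1 g2]; apply/Lp2P; split; first exact: cmeasD.
apply: (rint_le _ (rintZ 2 (rintD f2 g2))); first exact: (meas_normc2 (cmeasD f1 g1)).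
by move=> t; rewrite ger0_norm ?sqr_ge0 // normcD_sqr.
Qed.

Lemma Lp2J f : Lp 2%:E f -> Lp 2%:E (fun z => (f z)^*%R).
Proof.
move=> /Lp2P[f1 f2]; apply/Lp2P; split; first exact: cmeasJ.
by under eq_fun do rewrite normcJ.
Qed.

Lemma Lp2M f g : Lp 2%:E f -> Lp 2%:E g -> cintg (fun z => f z * g z).
Proof.
move=> /Lp2P[f1 f2] /Lp2P[g1 g2]; apply: (cintg_le (cmeasM f1 g1) (rintD f2 g2)) => t.
exact: normcM_le.
Qed.

Lemma Lp2_ae f g : Lp 2%:E f -> cmeas g -> aeT (fun z => f z = g z) -> Lp 2%:E g.
Proof.
move=> /Lp2P[f1 f2] g1 fg; apply/Lp2P; split=> //.
by apply: (rint_ae f2 _ fg) => [|t -> //]; exact: meas_normc2.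
Qed.

Definition cbnd b := cmeas b /\ exists M : R, aeT (fun z => normc (b z) <= M).

(** The norm of exponent [+oo] is defined by cases on the total mass being positive; this selects
    the essential supremum. *)
Lemma circle_gt0 : (0%R < (mu : measure _ _) setT)%E.
Proof. by have := @probability_setT _ _ _ mu; rewrite /= => h; rewrite [ltRHS]h lte01. Qed.

Lemma aeTW (P : C -> Prop) : (forall t, P (cis t)) -> aeT P.
Proof. by move=> h; apply: aeW => t; exact: h. Qed.

Lemma LpooP b : Lp +oo%E b <-> cbnd b.
Proof.
split=> [[b1 b2 b3]|[[b1 b2] [M hM]]].
- split=> //; move: b3; rewrite Lnorm.unlock. rewrite circle_gt0 => b3.
  have [|M hM] := @ess_supr_bounded _ _ R mu (fun t => normc (b (cis t))).
    move: b3; congr (ess_sup _ _ < _)%E; apply/funext => t /=.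
    by rewrite ger0_norm // normc_ge0.
  by exists M.
- split=> //; rewrite Lnorm.unlock circle_gt0.
  apply: (@le_lt_trans _ _ M%:E); last exact: ltry.
  apply/ess_supP; apply: (@filterS _ _ (ae_filter_ringOfSetsType mu)) hM => t h /=.
  by rewrite lee_fin ger0_norm // normc_ge0.
Qed.

Lemma cbnd_cst (c : C) : cbnd (fun=> c).
Proof. by split; [exact: cmeas_cst|exists (normc c); exact: aeTW]. Qed.

Lemma normc_cis (t : R) : normc (cis t) = 1.
Proof. by rewrite /cis /= cos2Dsin2 sqrtr1. Qed.

Lemma cbnd_id : cbnd id.
Proof. by split; [exact: cmeas_id|exists 1; apply: aeTW => t; rewrite normc_cis]. Qed.

Lemma cbndM f g : cbnd f -> cbnd g -> cbnd (fun z => f z * g z).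
Proof.
move=> [f1 [M hM]] [g1 [N hN]]; split; first exact: cmeasM.
exists (M * N); apply: aeTS (aeTI hM hN) => t [h1 h2].
by rewrite Normc.normcM ler_pM // normc_ge0.
Qed.

Lemma cbndD f g : cbnd f -> cbnd g -> cbnd (fun z => f z + g z).
Proof.
move=> [f1 [M hM]] [g1 [N hN]]; split; first exact: cmeasD.
exists (M + N); apply: aeTS (aeTI hM hN) => t [h1 h2].
by apply: le_trans (le_normcD _ _) _; exact: lerD.
Qed.

Lemma cbndJ f : cbnd f -> cbnd (fun z => (f z)^*%R).
Proof.
move=> [f1 [M hM]]; split; first exact: cmeasJ.
by exists M; under eq_fun do rewrite normcJ.
Qed.

Lemma cbnd_Lp2M b f : cbnd b -> Lp 2%:E f -> Lp 2%:E (fun z => b z * f z).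
Proof.
move=> [b1 [M hM]] /Lp2P[f1 f2]; apply/Lp2P; split; first exact: cmeasM.
apply/integrableP; split.
  by apply/measurable_EFinP; exact: (meas_normc2 (cmeasM b1 f1)).
have /integrableP[_ h] := rintZ (M ^+ 2) f2; apply: le_lt_trans h.
apply: ae_ge0_le_integral => //.
- by apply: measurableT_comp => //; apply/measurable_EFinP; exact: (meas_normc2 (cmeasM b1 f1)).
- by apply: measurableT_comp => //; apply/measurable_EFinP; apply: measurable_funM => //; exact: meas_normc2.
move: hM; rewrite /aeT; apply: (@filterS _ _ (ae_filter_ringOfSetsType mu)) => t h _ /=.
rewrite lee_fin Normc.normcM exprMn normrM [leRHS]normrM.
rewrite ler_wpM2r // !normrX lerXn2r ?nnegrE //.
by rewrite !ger0_norm ?normc_ge0 // (le_trans _ h) ?normc_ge0.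
Qed.

Lemma Lp2_cst (c : C) : Lp 2%:E (fun=> c).
Proof.
apply/Lp2P; split; first exact: cmeas_cst.
by apply: finite_measure_integrable_cst.
Qed.

Lemma cbnd_Lp2 b : cbnd b -> Lp 2%:E b.
Proof.
move=> hb; have := cbnd_Lp2M hb (Lp2_cst 1).
by under eq_fun do rewrite mulr1.
Qed.

Lemma integralT_sqr_ge0 f : 0 <= integralT (fun z => f z * (f z)^*%R).
Proof.
rewrite /integralT; under eq_Rintegral do rewrite normc_mulJ /=.
under [X in _ <= _ +i* X]eq_Rintegral do rewrite normc_mulJ /=.
rewrite Rintegral_cst // mul0r lecE /= eqxx /=; apply: Rintegral_ge0 => t _.
exact: sqr_ge0.
Qed.

Lemma integralT_sqr_eq0 f : Lp 2%:E f -> integralT (fun z => f z * (f z)^*%R) = 0 ->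
  aeT (fun z => f z = 0).
Proof.
move=> /Lp2P[f1 f2]; rewrite /integralT; under eq_Rintegral do rewrite normc_mulJ /=.
move=> [h _].
have E : (\int[mu]_t `|(normc (f (cis t)) ^+ 2)%:E| = 0)%E.
  under eq_integral do rewrite gee0_abs ?lee_fin ?sqr_ge0 //.
  rewrite -[LHS]fineK; last exact: (integrable_fin_num measurableT f2).
  by congr (_%:E).
have mE : measurable_fun setT (EFin \o (fun t : measurableTypeR R => normc (f (cis t)) ^+ 2)).
  by apply/measurable_EFinP; exact: (meas_normc2 f1).
have [hE _] := ae_eq_integral_abs mu measurableT mE.
apply: (@filterS _ _ (ae_filter_ringOfSetsType mu)) (hE E) => t /= /(_ I) [] /eqP.
by rewrite sqrf_eq0 => /eqP/Normc.eq0_normc.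
Qed.

(** One [M] serves all multipliers of modulus at most 1, in particular all powers of z, so the
    Fourier coefficients of [f] are uniformly bounded. [M] is twice the integral of |Re f| + |Im f|,
    once for each part of the result. *)
Lemma integralT_bound f : cintg f -> exists M : R, forall b,
  cmeas b -> (forall t, normc (b (cis t)) <= 1) -> normc (integralT (fun z => f z * b z)) <= M.
Proof.
move=> [f1 f2]; pose v t := `|Re (f (cis t))| + `|Im (f (cis t))|.
have hv : rint v by apply: rintD; [exact: (integrable_norm f1) | exact: (integrable_norm f2)].
exists (\int[mu]_t v t + \int[mu]_t v t) => b mb hb.
have le_v t : normc (f (cis t) * b (cis t)) <= v t.
  rewrite Normc.normcM; apply: le_trans (_ : normc (f (cis t)) <= _).
    by rewrite ler_piMr ?normc_ge0.
  rewrite -(@ler_pXn2r _ 2) ?nnegrE ?normc_ge0 ?addr_ge0 //.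
  rewrite normcE2 sqrrD !real_normK ?num_real // lerD2r lerDl.
  by rewrite mulrn_wge0 // mulr_ge0.
have [h1 h2] : cintg (fun z => f z * b z).
  by apply: (cintg_le _ hv le_v); apply: cmeasM => //; apply: cintg_meas; split.
rewrite /integralT.
have h (z : C) : normc z <= `|Re z| + `|Im z|.
  rewrite -(@ler_pXn2r _ 2) ?nnegrE ?normc_ge0 ?addr_ge0 //.
  rewrite normcE2 sqrrD !real_normK ?num_real // lerD2r lerDl.
  by rewrite mulrn_wge0 // mulr_ge0.
apply: le_trans (h (_ +i* _)) _ => /=; apply: lerD.
- apply: le_trans (le_normr_Rintegral _ h1) _ => //; apply: le_Rintegral => //.
    exact: (integrable_norm h1).
  by move=> t _; exact: le_trans (Re_le_normc _) (le_v t).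
- apply: le_trans (le_normr_Rintegral _ h2) _ => //; apply: le_Rintegral => //.
    exact: (integrable_norm h2).
  by move=> t _; exact: le_trans (Im_le_normc _) (le_v t).
Qed.
End SquareIntegrable.

(** * Integrals of powers of z *)

Section CircleIntegrals.
Context {R : realType}.
Local Notation C := R[i].
Local Notation mu := (@circle R).
Implicit Types f g h b : C -> C.

Lemma circle_FTC2 (f F : R -> R) : continuous f -> (forall t, 0 <= f t) ->
  (forall x : R, is_derive x (1 : R) F (f x)) ->
  \int[mu]_t f t = (2 * pi)^-1 * (F (2 * pi) - F 0).
Proof.
move=> cf f0 dF; rewrite /Rintegral /circle integral_uniform; last 2 first.
- by apply/measurable_EFinP; exact: continuous_measurable_fun.
- by move=> x; rewrite lee_fin.
have cF : continuous F.
  by move=> x; apply: differentiable_continuous; apply/derivable1_diffP; have [] := dF x.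
rewrite (@continuous_FTC2 _ _ F) ?twopi_gt0 //.
- by rewrite subr0 -EFinB -EFinM.
- exact: continuous_subspaceT.
- split.
  + by move=> x _; have [] := dF x.
  + exact/cvg_at_right_filter/cF.
  + exact/cvg_at_left_filter/cF.
- by move=> x _; rewrite derive1E; apply: derive_val.
Qed.

Lemma cisX (t : R) k : cis t ^+ k = cis (k%:R * t).
Proof.
elim: k => [|k IHk]; first by rewrite expr0 mul0r /cis cos0 sin0.
rewrite exprS IHk -natr1 mulrDl mul1r /cis cosD sinD.
by apply/eqP; rewrite eq_complex /=; apply/andP; split; apply/eqP; ring.
Qed.

Lemma sin2kpi k : sin (k%:R * (2 * pi)) = 0 :> R.
Proof.
elim: k => [|k IHk]; first by rewrite mul0r sin0.
by rewrite -natr1 mulrDl mul1r (mulr_natl pi 2) sinD2pi -(mulr_natl pi 2).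
Qed.

Lemma cos2kpi k : cos (k%:R * (2 * pi)) = 1 :> R.
Proof.
elim: k => [|k IHk]; first by rewrite mul0r cos0.
by rewrite -natr1 mulrDl mul1r (mulr_natl pi 2) cosD2pi -(mulr_natl pi 2).
Qed.

Lemma rint_cst (c : R) : rint (fun=> c).
Proof. exact: finite_measure_integrable_cst. Qed.

Lemma circle_int1 (c : R) : \int[mu]_t c = c.
Proof.
have := @probability_setT _ _ _ mu; rewrite Rintegral_cst //= => h.
by rewrite [X in fine X]h mulr1.
Qed.

Lemma integralT_cst (c : C) : integralT (fun=> c) = c.
Proof. by rewrite /integralT !circle_int1; case: c. Qed.

(** [circle_FTC2] asks for a nonnegative integrand, so 1 + cos and 1 + sin are integrated and the 1
    is subtracted afterwards. *)
Lemma integralT_X k : integralT (fun z : C => z ^+ k.+1) = 0.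
Proof.
rewrite /integralT; under eq_Rintegral do rewrite cisX /=.
under [X in _ +i* X = _]eq_Rintegral do rewrite cisX /=.
have mgt0 : (k.+1%:R : R) != 0 by rewrite pnatr_eq0.
move: (k.+1%:R : R) mgt0 (@cos2kpi k.+1) (@sin2kpi k.+1) => m m0 hc hs.
have cm : continuous (fun x : R => m * x) by exact: mulrl_continuous.
have cc : continuous (fun x => cos (m * x)).
  by move=> x; apply: continuous_comp; [exact: cm|exact: continuous_cos].
have cs : continuous (fun x => sin (m * x)).
  by move=> x; apply: continuous_comp; [exact: cm|exact: continuous_sin].
have rc : rint (fun t => cos (m * t)).
  apply: (rint_le _ (rint_cst 1)); first exact: continuous_measurable_fun.
  by move=> t; rewrite ler_norml cos_geN1 cos_le1.
have rs : rint (fun t => sin (m * t)).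
  apply: (rint_le _ (rint_cst 1)); first exact: continuous_measurable_fun.
  by move=> t; rewrite ler_norml sin_geN1 sin_le1.
have dc x : is_derive x (1 : R) (fun x => x + m^-1 * sin (m * x)) (1 + cos (m * x)).
  apply: is_derive_eq.
  by rewrite /GRing.scale /=; field.
have ds x : is_derive x (1 : R) (fun x => x - m^-1 * cos (m * x)) (1 + sin (m * x)).
  apply: is_derive_eq.
  by rewrite /GRing.scale /=; field.
have Ec : \int[mu]_t (1 + cos (m * t)) = 1.
  rewrite (circle_FTC2 _ _ dc).
  - by rewrite hs !mulr0 sin0 !mulr0 !addr0 subr0 mulVf // gt_eqF // twopi_gt0.
  - by move=> x; apply: cvgD; [exact: cvg_cst|exact: cc].
  - by move=> t; rewrite -lerBlDl sub0r cos_geN1.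
have Es : \int[mu]_t (1 + sin (m * t)) = 1.
  rewrite (circle_FTC2 _ _ ds).
  - by rewrite hc !mulr0 cos0 !mulr1 add0r opprK subrK mulVf // gt_eqF // twopi_gt0.
  - by move=> x; apply: cvgD; [exact: cvg_cst|exact: cs].
  - by move=> t; rewrite -lerBlDl sub0r sin_geN1.
move: Ec Es; rewrite !RintegralD ?circle_int1 //; try exact: rint_cst.
move=> /eqP; rewrite -subr_eq0 addrAC subrr add0r => /eqP ->.
by move=> /eqP; rewrite -subr_eq0 addrAC subrr add0r => /eqP ->.
Qed.
End CircleIntegrals.

(** * The scalar Hardy space *)

Section HardyScalar.
Context {R : realType}.
Local Notation C := R[i].
Local Notation Re := (@complex.Re R).
Local Notation Im := (@complex.Im R).
Local Notation normc := Normc.normc.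
Implicit Types f g h b : C -> C.
Local Notation H2 := (Hp 2%:E).

Lemma integralT_ext f g : (forall t, f (cis t) = g (cis t)) -> integralT f = integralT g.
Proof. by move=> fg; rewrite /integralT; congr (_ +i* _); apply: eq_Rintegral => t _; rewrite fg. Qed.

Lemma normE (z : C) : `|z| = (normc z)%:C. Proof. by case: z. Qed.

Lemma norm_realC (x : R) : `|x%:C| = `|x|%:C.
Proof. by rewrite normc_def /= expr0n /= addr0 sqrtr_sqr. Qed.

Lemma mul_cisJ (t : R) : cis t * ((cis t)^*)%R = 1.
Proof. by rewrite normc_mulJ normc_cis expr1n. Qed.

Lemma cis_neq0 (t : R) : cis t != 0.
Proof. by apply/eqP => h; have := mul_cisJ t; rewrite h mul0r => /eqP; rewrite eq_sym oner_eq0. Qed.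

Lemma cisJ (t : R) : ((cis t)^*)%R = (cis t)^-1.
Proof. by apply: (mulfI (cis_neq0 t)); rewrite mul_cisJ mulfV ?cis_neq0. Qed.

Lemma norm_cis (t : R) : `|cis t| = 1. Proof. by rewrite normE normc_cis. Qed.

Lemma cis_subr_neq0 (a : C) t : `|a| != 1 -> cis t - a != 0.
Proof. by apply: contra; rewrite subr_eq0 => /eqP <-; rewrite norm_cis. Qed.

Lemma subr_mul_neq0 (a : C) t : `|a| < 1 -> 1 - a * cis t != 0.
Proof.
move=> ha; rewrite subr_eq0; apply/eqP => h.
have : `|a * cis t| < 1 by rewrite normrM norm_cis mulr1.
by rewrite -h normr1 ltxx.
Qed.

Lemma Re_inv (w : C) : Re w^-1 = Re w / (Re w ^+ 2 + Im w ^+ 2).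
Proof. by case: w. Qed.

Lemma Im_inv (w : C) : Im w^-1 = - (Im w / (Re w ^+ 2 + Im w ^+ 2)).
Proof. by case: w. Qed.

Lemma cbnd_inv (a : C) : `|a| != 1 -> cbnd (fun z => (z - a)^-1).
Proof.
move=> ha.
have N0 t : Re (cis t - a) ^+ 2 + Im (cis t - a) ^+ 2 != 0.
  rewrite -normcE2 sqrf_eq0; apply: contra (cis_subr_neq0 t ha).
  by move=> /eqP/Normc.eq0_normc ->.
have cR : continuous (fun t : R => Re (cis t - a)).
  rewrite (_ : (fun _ => _) = (fun t => cos t - Re a)).
    by move=> t; apply: cvgB; [exact: continuous_cos|exact: cvg_cst].
  by apply/funext => t; case: (a).
have cI : continuous (fun t : R => Im (cis t - a)).
  rewrite (_ : (fun _ => _) = (fun t => sin t - Im a)).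
    by move=> t; apply: cvgB; [exact: continuous_sin|exact: cvg_cst].
  by apply/funext => t; case: (a).
have cN : continuous (fun t : R => (Re (cis t - a) ^+ 2 + Im (cis t - a) ^+ 2)^-1).
  move=> t; apply: cvgV; first exact: N0.
  by apply: cvgD; apply: cvgM; (exact: cR || exact: cI).
split.
  split; apply: continuous_measurable_fun.
  - under eq_fun do rewrite Re_inv.
    by move=> t; apply: cvgM; [exact: cR|exact: cN].
  - under eq_fun do rewrite Im_inv.
    by move=> t; apply: cvgN; apply: cvgM; [exact: cI|exact: cN].
(* Reverse triangle inequality: |z - a| is at least |1 - |a|| on the circle. *)
exists (`|1 - normc a|^-1); apply: aeTW => t.
have h0 : 0 < `|1 - normc a|.
  by rewrite normr_gt0 subr_eq0; apply: contra ha => /eqP h; rewrite normE -h.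
rewrite Normc.normcV lef_pV2 ?posrE //.
  rewrite -lecR -normE; apply: le_trans (ler_dist_dist _ _).
  rewrite norm_cis (normE a) (_ : 1 - _ = (1 - normc a)%:C); last by rewrite rmorphB.
  by rewrite norm_realC.
rewrite lt_def normc_ge0 andbT; apply: contra (cis_subr_neq0 t ha).
by move=> /eqP/Normc.eq0_normc ->.
Qed.

Lemma cbnd_invout (a : C) : `|a| < 1 -> cbnd (fun z => (1 - a * z)^-1).
Proof.
move=> ha; have [->|a0] := eqVneq a 0.
  by under eq_fun do rewrite mul0r subr0; exact: cbnd_cst.
have -> : (fun z => (1 - a * z)^-1) = (fun z => (- a)^-1 * (z - a^-1)^-1).
  by apply/funext => z; rewrite -invfM; congr (_^-1); field.
apply: cbndM (cbnd_cst _) (cbnd_inv _).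
by rewrite normfV invr_eq1 lt_eqF.
Qed.

Lemma H2_Lp f : H2 f -> Lp 2%:E f. Proof. by case. Qed.

Lemma H2_meas f : H2 f -> cmeas f. Proof. by move/H2_Lp/Lp2_meas. Qed.

Lemma cbndX k : cbnd (fun z : C => z ^+ k).
Proof.
elim: k => [|k IHk]; first by under eq_fun do rewrite expr0; exact: cbnd_cst.
by under eq_fun do rewrite exprS; exact: (cbndM cbnd_id IHk).
Qed.

Lemma Lp2_cintg f b : Lp 2%:E f -> cbnd b -> cintg (fun z => f z * b z).
Proof. by move=> hf hb; exact: (Lp2M hf (cbnd_Lp2 hb)). Qed.

Lemma H2D f g : H2 f -> H2 g -> H2 (fun z => f z + g z).
Proof.
move=> [f1 f2] [g1 g2]; split=> [|k]; first exact: Lp2D.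
under [X in integralT X]eq_fun do rewrite mulrDl.
by rewrite integralTD ?f2 ?g2 ?addr0 //; apply: Lp2_cintg => //; exact: cbndX.
Qed.

Lemma Lp2Z c f : Lp 2%:E f -> Lp 2%:E (fun z => c * f z).
Proof. by move=> hf; exact: (cbnd_Lp2M (cbnd_cst c) hf). Qed.

Lemma H2Z c f : H2 f -> H2 (fun z => c * f z).
Proof.
move=> [f1 f2]; split=> [|k]; first exact: Lp2Z.
under [X in integralT X]eq_fun do rewrite -mulrA.
by rewrite integralTZ ?f2 ?mulr0 //; apply: Lp2_cintg => //; exact: cbndX.
Qed.

Lemma H2_cst (c : C) : H2 (fun=> c).
Proof.
split=> [|k]; first exact: Lp2_cst.
by rewrite integralTZ ?integralT_X ?mulr0 //; apply: cintg_le (cbndX _).1 (rint_cst 1) _ => t;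
  rewrite cisX normc_cis.
Qed.

Lemma H2_ae f g : H2 f -> cmeas g -> aeT (fun z => f z = g z) -> H2 g.
Proof.
move=> [f1 f2] mg fg; split=> [|k]; first exact: Lp2_ae fg.
rewrite -(f2 k); apply: integralT_ae.
- by apply: cmeasM => //; exact: (cbndX _).1.
- by apply: cmeasM => //; [exact: Lp2_meas|exact: (cbndX _).1].
- by apply: aeTS fg => t ->.
Qed.

Lemma H2_mulz f : H2 f -> H2 (fun z => z * f z).
Proof.
move=> [f1 f2]; split=> [|k]; first exact: (cbnd_Lp2M cbnd_id f1).
by rewrite -(f2 k.+1); apply: integralT_ext => t; rewrite (exprS _ k.+1) mulrA [f _ * _]mulrC.
Qed.

Lemma H2_horner (p : {poly C}) f : H2 f -> H2 (fun z => p.[z] * f z).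
Proof.
move=> hf; elim/poly_ind: p => [|p c IHp].
  by under eq_fun do rewrite horner0 mul0r; exact: H2_cst.
rewrite (_ : (fun z => _) = (fun z => z * (p.[z] * f z) + c * f z)).
  exact: H2D (H2_mulz IHp) (H2Z _ hf).
by apply/funext => z; rewrite hornerMXaddC; ring.
Qed.

Lemma H2_poly (p : {poly C}) : H2 (fun z => p.[z]).
Proof. by have := H2_horner p (H2_cst 1); under eq_fun do rewrite mulr1. Qed.

Lemma geom_eq0 (x q M : R) : 0 <= q < 1 -> 0 <= x -> (forall m, x <= q ^+ m * M) -> x = 0.
Proof.
move=> /andP[q0 q1] x0 h; apply/eqP; rewrite eq_le x0 andbT.
have cv : (q ^+ n * M @[n --> \oo] --> 0 * M)%classic.
  by apply: cvgM; [apply: cvg_expr; rewrite ger0_norm | exact: cvg_cst].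
rewrite mul0r in cv.
rewrite -(cvg_lim _ cv) //; apply: limr_ge; first by apply/cvg_ex; exists 0.
exact: nearW.
Qed.

(** With F = f / (1 - a z), the relation F = f + a z F gives [J k = a * J k.+1] for the negative
    coefficients. Hence [J k] is [a ^+ m] times a coefficient bounded independently of [m], and it
    vanishes as |a| < 1. *)
Lemma H2_divout f (a : C) : `|a| < 1 -> H2 f -> H2 (fun z => (1 - a * z)^-1 * f z).
Proof.
move=> ha [f1 f2]; pose F z := (1 - a * z)^-1 * f z.
have F1 : Lp 2%:E F by exact: (cbnd_Lp2M (cbnd_invout ha) f1).
split=> // k; pose J k := integralT (fun z => F z * z ^+ k.+1).
have cF j : cintg (fun z => F z * z ^+ j) by exact: Lp2_cintg F1 (cbndX j).
have JS j : J j = a * J j.+1.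
  rewrite /J -integralTZ // -[LHS]add0r -(f2 j) -[RHS]addr0.
  have -> : integralT (fun z => F z * z ^+ j.+1) =
    integralT (fun z => f z * z ^+ j.+1 + a * (F z * z ^+ j.+2)).
    apply: integralT_ext => t; rewrite /F (exprS _ j.+1); have := subr_mul_neq0 t ha.
    by move: (cis t) (f _) (_ ^+ _) => z w v h; field.
  rewrite integralTD ?f2 ?add0r ?addr0 //; last exact: cintgZ.
  by apply: Lp2_cintg f1 (cbndX _).
have JM m : J k = a ^+ m * J (k + m)%N.
  elim: m => [|m ->]; first by rewrite expr0 mul1r addn0.
  by rewrite JS addnS exprSr mulrA.
have [M hM] := integralT_bound (Lp2_cintg F1 (cbnd_cst 1)).
apply: Normc.eq0_normc; apply: (@geom_eq0 _ (normc a) M).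
- by rewrite normc_ge0 /= -ltcR -normE.
- exact: normc_ge0.
- move=> m; rewrite -[integralT _]/(J k) (JM m) Normc.normcM.
  have -> : normc (a ^+ m) = normc a ^+ m.
    by elim: m => [|m IH]; rewrite ?expr0 ?Normc.normc1 // !exprS Normc.normcM IH.
  apply: ler_wpM2l; first by rewrite exprn_ge0 // normc_ge0.
  have := hM (fun z => z ^+ (k + m).+1) (cbndX _).1; rewrite /J.
  rewrite (_ : integralT _ = integralT (fun z => F z * z ^+ (k + m).+1)); last first.
    by apply: integralT_ext => t; rewrite mulr1.
  by apply=> t; rewrite cisX normc_cis.
Qed.
End HardyScalar.

(** * Cauchy integrals, values in the disc, and the scalar projection *)

Section SzegoProjection.
Context {R : realType}.
Local Notation C := R[i].
Implicit Types f g h b : C -> C.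
Local Notation H2 := (Hp 2%:E).

Lemma cintg_cbnd b : cbnd b -> cintg b.
Proof.
move=> hb; have := Lp2_cintg (Lp2_cst 1) hb.
by under eq_fun do rewrite mul1r.
Qed.

Lemma H2_integral_mulz f : H2 f -> integralT (fun z => z * f z) = 0.
Proof. by case=> _ /(_ 0%N) <-; apply: integralT_ext => t; rewrite expr1 mulrC. Qed.

(** Conjugation is inversion on the circle, so it exchanges the pole at [a] inside the disc with the
    pole of the Szego kernel outside it. *)
Lemma szego_conj (a : C) (t : R) : `|a| < 1 ->
  (((cis t - a)^-1)^*)%R = cis t * (1 - a^*%R * cis t)^-1.
Proof.
move=> ha; have ha' : `|a^*%R| < 1 by rewrite norm_conjC.
have h1 := subr_mul_neq0 t ha'; have h0 := cis_neq0 t.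
rewrite fmorphV rmorphB /= cisJ.
have -> : (cis t)^-1 - a^*%R = (1 - a^*%R * cis t) / cis t by field.
by rewrite invf_div.
Qed.

(** The conjugate of the integrand is the Szego kernel, which is 1 plus z times an H^2 function. *)
Lemma szego_integral (a : C) : `|a| < 1 -> integralT (fun z => z * (z - a)^-1) = 1.
Proof.
move=> ha; have ha' : `|a^*%R| < 1 by rewrite norm_conjC.
have hk : H2 (fun z => (1 - a^*%R * z)^-1 * 1) by exact: H2_divout ha' (H2_cst 1).
have bk := cbnd_invout ha'.
rewrite -[LHS]conjCK -integralTJ; last first.
  by apply/cintg_cbnd/cbndM; [exact: cbnd_id|apply: cbnd_inv; rewrite lt_eqF].
rewrite (@integralT_ext _ _ (fun z => 1 + a^*%R * (z * ((1 - a^*%R * z)^-1 * 1)))); last first.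
  move=> t; rewrite rmorphM /= szego_conj // cisJ.
  have := subr_mul_neq0 t ha'; have := cis_neq0 t; by move: (cis t) (a^*%R) => z b h1 h2; field; rewrite h1 h2.
rewrite integralTD ?integralT_cst ?integralTZ ?(H2_integral_mulz hk) ?mulr0 ?addr0 ?rmorph1 //.
- exact/cintg_cbnd/cbndM/cbndM/cbnd_cst/bk/cbnd_id.
- exact/cintg_cbnd/cbnd_cst.
- exact/cintgZ/cintg_cbnd/cbndM/cbndM/cbnd_cst/bk/cbnd_id.
Qed.

(* For f in H^2 this is the value at a of the analytic extension of f to the disc. *)
Definition ev f (a : C) : C := integralT (fun z => f z * (z * (z - a)^-1)).

Lemma cbnd_szego (a : C) : `|a| < 1 -> cbnd (fun z => z * (z - a)^-1).
Proof. by move=> ha; apply: cbndM cbnd_id (cbnd_inv _); rewrite lt_eqF. Qed.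

Lemma Lp2N f : Lp 2%:E f -> Lp 2%:E (fun z => - f z).
Proof. by move=> hf; have := Lp2Z (-1) hf; under eq_fun do rewrite mulN1r. Qed.

Lemma H2N f : H2 f -> H2 (fun z => - f z).
Proof. by move=> hf; have := H2Z (-1) hf; under eq_fun do rewrite mulN1r. Qed.

Lemma Lp2B f g : Lp 2%:E f -> Lp 2%:E g -> Lp 2%:E (fun z => f z - g z).
Proof. by move=> hf /Lp2N hg; exact: Lp2D. Qed.

Lemma H2B f g : H2 f -> H2 g -> H2 (fun z => f z - g z).
Proof. by move=> hf /H2N hg; exact: H2D. Qed.

(** The factor theorem in H^2. The coefficient of index -1 vanishes by the choice of the constant
    [ev f a], and z / (z - a) = 1 + a / (z - a) makes each further coefficient [a] times the
    previous one. *)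
Lemma H2_divin f (a : C) : `|a| < 1 -> H2 f ->
  H2 (fun z => (z - a)^-1 * (f z - ev f a)).
Proof.
move=> ha hf; have ha1 : `|a| != 1 by rewrite lt_eqF.
have hc : H2 (fun z => f z - ev f a) by exact: H2B hf (H2_cst _).
have hF : Lp 2%:E (fun z => (z - a)^-1 * (f z - ev f a)).
  exact: (cbnd_Lp2M (cbnd_inv ha1) (H2_Lp hc)).
split=> //; elim=> [|k IHk].
  rewrite (@integralT_ext _ _ (fun z => f z * (z * (z - a)^-1) + - ev f a * (z * (z - a)^-1))).
    rewrite integralTD ?integralTZ ?szego_integral // ?mulr1 ?subrr //.
    - exact/cintg_cbnd/cbnd_szego.
    - exact: Lp2_cintg (H2_Lp hf) (cbnd_szego ha).
    - exact/cintgZ/cintg_cbnd/cbnd_szego.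
  by move=> t; ring.
rewrite (@integralT_ext _ _ (fun z => (f z - ev f a) * z ^+ k.+1 +
   a * ((z - a)^-1 * (f z - ev f a) * z ^+ k.+1))); last first.
  move=> t; rewrite (exprS _ k.+1); have := cis_subr_neq0 t ha1.
  by move: (cis t) (ev _ _) (cis t ^+ _) (f _) => z w v u h; field.
rewrite integralTD ?integralTZ ?IHk ?mulr0 ?addr0 //.
- by case: hc.
- exact: Lp2_cintg hF (cbndX _).
- exact: Lp2_cintg (H2_Lp hc) (cbndX _).
- exact/cintgZ/(Lp2_cintg hF)/cbndX.
Qed.

(** Any first order expansion at [a] with remainder in H^2 reveals the value; this gives
    multiplicativity by polynomials without power series. *)
Lemma ev_unique f g (a c : C) : `|a| < 1 -> cmeas f -> H2 g ->
  aeT (fun z => f z = c + (z - a) * g z) -> ev f a = c.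
Proof.
move=> ha mf hg hfg; have ha1 : `|a| != 1 by rewrite lt_eqF.
have hz : integralT (fun z => c * (z * (z - a)^-1) + z * g z) = c.
  rewrite integralTD ?integralTZ ?szego_integral ?(H2_integral_mulz hg) ?mulr1 ?addr0 //.
  - exact/cintg_cbnd/cbnd_szego.
  - exact/cintgZ/cintg_cbnd/cbnd_szego.
  - exact: Lp2M (cbnd_Lp2 cbnd_id) (H2_Lp hg).
rewrite -[RHS]hz; apply: integralT_ae.
- by apply: cmeasM => //; case: (cbnd_szego ha).
- apply: cmeasD; first by apply: cmeasM; [exact: cmeas_cst|case: (cbnd_szego ha)].
  by apply: cmeasM; [exact: cmeas_id|exact: H2_meas].
apply: aeTS hfg => t ->; have := cis_subr_neq0 t ha1.
by move: (cis t) (g _) => z w h; field.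
Qed.

Lemma H2_decomp f (a : C) : `|a| < 1 -> H2 f ->
  exists2 g, H2 g & forall t, f (cis t) = ev f a + (cis t - a) * g (cis t).
Proof.
move=> ha hf; exists (fun z => (z - a)^-1 * (f z - ev f a)); first exact: H2_divin.
by move=> t; rewrite mulrA mulfV ?mul1r ?cis_subr_neq0 ?lt_eqF // addrC subrK.
Qed.

Lemma H2_mul_subr g (a : C) : H2 g -> H2 (fun z => (z - a) * g z).
Proof. by move=> hg; have := H2_horner ('X - a%:P) hg; under eq_fun do rewrite hornerXsubC. Qed.

Lemma ev_poly (p : {poly C}) (a : C) : `|a| < 1 -> ev (fun z => p.[z]) a = p.[a].
Proof.
move=> ha; have /factor_theorem[q hq] : root (p - p.[a]%:P) a.
  by rewrite /root !hornerE subrr.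
apply: (@ev_unique _ (fun z => q.[z])) => //.
- exact/H2_meas/H2_poly.
- exact: H2_poly.
apply: aeTW => t; have := congr1 (horner^~ (cis t)) hq; rewrite !hornerE /= => /eqP.
by rewrite subr_eq addrC mulrC => /eqP.
Qed.

Lemma ev_mul_poly (p : {poly C}) f (a : C) : `|a| < 1 -> H2 f ->
  ev (fun z => p.[z] * f z) a = p.[a] * ev f a.
Proof.
move=> ha hf; have [g hg fE] := H2_decomp ha hf.
have [k hk pE] := H2_decomp ha (H2_poly p); rewrite ev_poly // in pE.
apply: (@ev_unique _ (fun z => p.[z] * g z + ev f a * k z)) => //.
- exact/H2_meas/H2_horner.
- by apply: H2D; [exact: H2_horner|exact: H2Z].
apply: aeTW => t; rewrite mulrDr [(_ - _) * (ev f a * _)]mulrCA.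
rewrite (_ : (cis t - a) * k (cis t) = p.[cis t] - p.[a]); last by rewrite [in RHS]pE addrAC subrr add0r.
by rewrite fE; ring.
Qed.

Lemma ev_ae f g (a : C) : `|a| < 1 -> cmeas f -> cmeas g -> aeT (fun z => f z = g z) -> ev f a = ev g a.
Proof.
move=> ha mf mg fg; have [ms _] := cbnd_szego ha.
by apply: integralT_ae; [exact: cmeasM|exact: cmeasM|apply: aeTS fg => t ->].
Qed.

Lemma evD f g (a : C) : `|a| < 1 -> H2 f -> H2 g -> ev (fun z => f z + g z) a = ev f a + ev g a.
Proof.
move=> ha hf hg; rewrite /ev; under [X in integralT X]eq_fun do rewrite mulrDl.
by apply: integralTD; apply: Lp2_cintg; (apply: H2_Lp || apply: cbnd_szego).
Qed.

Lemma evZ c f (a : C) : `|a| < 1 -> H2 f -> ev (fun z => c * f z) a = c * ev f a.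
Proof.
move=> ha hf; rewrite /ev; under [X in integralT X]eq_fun do rewrite -mulrA.
by apply: integralTZ; apply: Lp2_cintg; (apply: H2_Lp || apply: cbnd_szego).
Qed.

(** By the Cauchy formula the vanishing passes from the circle to the whole disc, where a nonzero
    polynomial has too many zeros. *)
Lemma poly_ae_eq0 (p : {poly C}) : aeT (fun z => p.[z] = 0) -> p = 0.
Proof.
move=> hp; have h0 (a : C) : `|a| < 1 -> p.[a] = 0.
  move=> ha; rewrite -ev_poly //.
  rewrite (ev_ae ha _ (@cmeas_cst _ 0) hp); last exact/H2_meas/H2_poly.
  by rewrite /ev (@integralT_ext _ _ (fun=> 0)) ?integralT_cst // => t; rewrite mul0r.
apply/eqP; apply: contraT => p0.
(* The points 1/2, 1/3, ... of the disc, as many as the size of [p], hence one more than its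
   degree. *)
pose s := [seq (i.+2%:R : C)^-1 | i <- iota 0 (size p)].
have := @max_poly_roots _ p s p0.
rewrite size_map size_iota ltnn => -> //.
- apply/allP => x /mapP[i _ ->]; rewrite /root h0 //.
  by rewrite normfV normr_nat invf_lt1 ?ltr1n ?ltr0n.
- rewrite map_inj_uniq ?iota_uniq // => i j /invr_inj/eqP.
  by rewrite eqr_nat => /eqP[].
Qed.

Lemma integral_szego_antiholo g (a : C) : `|a| < 1 -> H2 g ->
  integralT (fun z => (z - a)^-1 * (g z)^*%R) = 0.
Proof.
move=> ha hg; have ha' : `|a^*%R| < 1 by rewrite norm_conjC.
rewrite -[LHS]conjCK -integralTJ; last first.
  apply: Lp2M; first by apply/cbnd_Lp2/cbnd_inv; rewrite lt_eqF.
  exact/Lp2J/H2_Lp.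
rewrite (@integralT_ext _ _ (fun z => z * ((1 - a^*%R * z)^-1 * g z))).
  by rewrite H2_integral_mulz ?rmorph0 //; exact: H2_divout.
by move=> t; rewrite rmorphM /= conjCK szego_conj // mulrA.
Qed.

(** A relation and not a function: existence of the projection is established only for quotients of
    H^2 functions by polynomials, in [sproj_exists]. *)
Definition sproj f h := H2 h /\ forall g, H2 g -> integralT (fun z => (f z - h z) * (g z)^*%R) = 0.

Lemma sproj_H2 f : H2 f -> sproj f f.
Proof.
move=> hf; split=> // g _; rewrite (@integralT_ext _ _ (fun=> 0)) ?integralT_cst //.
by move=> t; rewrite subrr mul0r.
Qed.

Lemma Lp2_ip f g : Lp 2%:E f -> Lp 2%:E g -> cintg (fun z => f z * (g z)^*%R).
Proof. by move=> hf /Lp2J hg; exact: Lp2M. Qed.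

Lemma sproj_ae f f' h : Lp 2%:E f -> cmeas f' -> aeT (fun z => f z = f' z) -> sproj f h -> sproj f' h.
Proof.
move=> F mf ff [H P]; split=> // g hg; rewrite -(P g hg); apply: integralT_ae.
- apply: cmeasM; last exact/cmeasJ/H2_meas.
  by apply: cmeasD => //; exact/H2_meas/H2N.
- apply: cmeasM; last exact/cmeasJ/H2_meas.
  by apply: cmeasD => //; [exact: Lp2_meas|exact/H2_meas/H2N].
- by apply: aeTS ff => t ->.
Qed.

(** Division by z - a keeps f - h orthogonal to H^2, its adjoint being multiplication by an H^2
    multiplier, while h / (z - a) splits into (h - h(a)) / (z - a), in H^2, and h(a) / (z - a),
    orthogonal to H^2. *)
Lemma sproj_divin f h (a : C) : `|a| < 1 -> Lp 2%:E f -> sproj f h ->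
  sproj (fun z => (z - a)^-1 * f z) (fun z => (z - a)^-1 * (h z - ev h a)).
Proof.
move=> ha F [H P]; have ha' : `|a^*%R| < 1 by rewrite norm_conjC.
have ha1 : `|a| != 1 by rewrite lt_eqF.
split; first exact: H2_divin.
move=> g hg; rewrite (@integralT_ext _ _ (fun z =>
   (f z - h z) * (z * ((1 - a^*%R * z)^-1 * g z))^*%R + ev h a * ((z - a)^-1 * (g z)^*%R))).
  have hG : H2 (fun z => z * ((1 - a^*%R * z)^-1 * g z)) by exact/H2_mulz/H2_divout.
  rewrite integralTD ?integralTZ ?(P _ hG) ?integral_szego_antiholo ?mulr0 ?addr0 //.
  - exact: Lp2_ip (cbnd_Lp2 (cbnd_inv ha1)) (H2_Lp hg).
  - by apply: Lp2_ip; [apply: Lp2B => //|]; exact: H2_Lp.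
  - by apply: cintgZ; exact: Lp2_ip (cbnd_Lp2 (cbnd_inv ha1)) (H2_Lp hg).
by move=> t; rewrite mulrA rmorphM /= -szego_conj // conjCK; ring.
Qed.
End SzegoProjection.

(** * Poles on the circle are not square integrable *)

Section CirclePoles.
Context {R : realType}.
Local Notation C := R[i].
Implicit Types f g h b : C -> C.
Local Notation H2 := (Hp 2%:E).

Lemma cbnd_geom (w : C) N : cbnd (fun z => \sum_(k < N) (w * z) ^+ k).
Proof.
elim: N => [|N IHN]; first by under eq_fun do rewrite big_ord0; exact: cbnd_cst.
rewrite (_ : (fun _ => _) = fun z => 1 + (w * z) * \sum_(k < N) (w * z) ^+ k).
  exact: cbndD (cbnd_cst 1) (cbndM (cbndM (cbnd_cst _) cbnd_id) IHN).
apply/funext => z; rewrite big_ord_recl expr0 mulr_sumr; congr (_ + _).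
by apply: eq_bigr => i _; rewrite -exprS.
Qed.

(** Orthonormality of the powers of w z, through the recursion S_{n+1} = 1 + w z S_n: the cross
    terms have mean zero and the factor w z has modulus 1. *)
Lemma integralT_sum_unit (w : C) N : `|w| = 1 ->
  integralT (fun z => (\sum_(k < N) (w * z) ^+ k) * (\sum_(k < N) (w * z) ^+ k)^*%R) = N%:R.
Proof.
move=> hw; pose S n z := \sum_(k < n) (w * z) ^+ k.
change (integralT (fun z => S N z * (S N z)^*%R) = N%:R).
have HS n : H2 (S n).
  elim: n => [|n IHn].
    rewrite (_ : S 0%N = fun=> 0); first exact: H2_cst.
    by apply/funext => z; rewrite /S big_ord0.
  rewrite (_ : S n.+1 = fun z => 1 + w * (z * S n z)).
    by apply: H2D (H2_cst 1) _; exact/H2Z/H2_mulz.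
  apply/funext => z; rewrite /S big_ord_recl expr0 mulrA mulr_sumr; congr (_ + _).
  by apply: eq_bigr => i _; rewrite -exprS.
elim: N => [|n IHn].
  rewrite (@integralT_ext _ _ (fun=> 0)) ?integralT_cst //.
  by move=> t; rewrite /S big_ord0 mul0r.
have hT : H2 (fun z => w * (z * S n z)) by exact/H2Z/H2_mulz.
have iT : integralT (fun z => w * (z * S n z)) = 0.
  by rewrite integralTZ ?H2_integral_mulz ?mulr0 //; exact: Lp2M (cbnd_Lp2 cbnd_id) (H2_Lp (HS n)).
have cT : cintg (fun z => w * (z * S n z)).
  by have := Lp2M (H2_Lp hT) (Lp2_cst 1); under eq_fun do rewrite mulr1.
rewrite (@integralT_ext _ _ (fun z => (1 + w * (z * S n z)) + ((w * (z * S n z))^*%R + S n z * (S n z)^*%R))).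
  have c1 : cintg (fun=> 1 : C) by exact/cintg_cbnd/cbnd_cst.
  have c2 := cintgJ cT.
  have c3 := Lp2_ip (H2_Lp (HS n)) (H2_Lp (HS n)).
  rewrite (integralTD (cintgD c1 cT) (cintgD c2 c3)) (integralTD c1 cT) (integralTD c2 c3).
  by rewrite integralT_cst integralTJ // iT IHn rmorph0 addr0 add0r -natr1 addrC.
move=> t; have -> : S n.+1 (cis t) = 1 + w * (cis t * S n (cis t)).
  rewrite /S big_ord_recl expr0 mulrA mulr_sumr; congr (_ + _).
  by apply: eq_bigr => i _; rewrite -exprS.
have hw1 : w * w^*%R = 1 by rewrite -normCK hw expr1n.
have := mul_cisJ t; rewrite !rmorphD !rmorphM !rmorph1 /=.
move: (S n (cis t)) => x; move: (cis t) => z hz.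
rewrite (_ : (1 + w * (z * x)) * (1 + w^*%R * (z^*%R * x^*%R)) = 1 + w * (z * x) +
  (w^*%R * (z^*%R * x^*%R)+ (w * w^*%R) * (z * z^*%R) * (x * x^*%R))); last by ring.
by rewrite hw1 hz !mul1r.
Qed.

Lemma ge0_natbounded (x : C) (K : C) : 0 <= x -> (forall N : nat, N%:R * x <= K) -> x = 0.
Proof.
move=> x0 h; have [K0 Kr] : 0 <= K /\ K = (complex.Re K)%:C.
  have K0 : 0 <= K by have := h 0%N; rewrite mul0r.
  by split=> //; rewrite RRe_real // ger0_real.
have xr : x = (complex.Re x)%:C by rewrite RRe_real // ger0_real.
have h' (N : nat) : N%:R * complex.Re x <= complex.Re K.
  by rewrite -lecR rmorphM rmorph_nat /= -xr -Kr.
have rx0 : 0 <= complex.Re x by rewrite -lecR -xr.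
rewrite xr; congr (_%:C); apply/eqP; rewrite eq_le rx0 andbT leNgt; apply/negP => rx.
have := archi_boundP (_ : 0 <= complex.Re K / complex.Re x).
rewrite divr_ge0 // -?lecR -?Kr // => /(_ isT); rewrite ltr_pdivrMr //.
by rewrite ltNge h'.
Qed.

(* With S_N the geometric sum of N powers of z / a, the factor e - (z / a)^N e has
   modulus |S_N| on the circle: its norm, at most 2 |e|, would be sqrt N. *)
Lemma circle_pole_notin_Lp2 e (a : C) : `|a| = 1 -> Lp 2%:E e -> ~ aeT (fun z => (z - a) * e z = 1).
Proof.
move=> ha he hae; have aJ : a * a^*%R = 1 by rewrite -normCK ha expr1n.
have a0 : a != 0 by rewrite -normr_eq0 ha oner_eq0.
have haJ : `|a^*%R| = 1 by rewrite norm_conjC.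
pose I := integralT (fun z => e z * (e z)^*%R).
suff h (N : nat) : N%:R * 1 <= 4 * I.
  by have /eqP := ge0_natbounded ler01 h; rewrite oner_eq0.
pose b z := (a^*%R * z) ^+ N.
have hb : cbnd b.
  rewrite /b; elim: (N) => [|k IHk]; first by under eq_fun do rewrite expr0; exact: cbnd_cst.
  by under eq_fun do rewrite exprS; exact: cbndM (cbndM (cbnd_cst _) cbnd_id) IHk.
have hbe : Lp 2%:E (fun z => b z * e z) by exact: cbnd_Lp2M.
have bJ t : b (cis t) * (b (cis t))^*%R = 1.
  by rewrite -normCK /b normrX normrM haJ norm_cis mulr1 !expr1n.
have Ib : integralT (fun z => (b z * e z) * (b z * e z)^*%R) = I.
  apply: integralT_ext => t; rewrite rmorphM /= mulrACA bJ mul1r //.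
have hd : Lp 2%:E (fun z => e z - b z * e z) by exact: Lp2B.
have hs : Lp 2%:E (fun z => e z + b z * e z) by exact: Lp2D.
have par : integralT (fun z => (e z - b z * e z) * (e z - b z * e z)^*%R) +
           integralT (fun z => (e z + b z * e z) * (e z + b z * e z)^*%R) = 4 * I.
  rewrite -integralTD; try exact: Lp2_ip.
  rewrite (@integralT_ext _ _ (fun z => 2 * (e z * (e z)^*%R) + 2 * ((b z * e z) * (b z * e z)^*%R))).
    rewrite integralTD ?integralTZ ?Ib -/I; try exact/cintgZ/Lp2_ip; try exact: Lp2_ip.
    by ring.
  by move=> t; rewrite !rmorphD rmorphN /=; ring.
rewrite -par mulr1 -(integralT_sum_unit N haJ).
rewrite (_ : integralT _ = integralT (fun z => (e z - b z * e z) * (e z - b z * e z)^*%R)).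
  by rewrite lerDl integralT_sqr_ge0.
have hS := cbnd_geom (a^*%R) N.
apply: integralT_ae.
- by apply: cmeasM; [case: hS|case: (cbndJ hS)].
- by apply: cmeasM; [exact: Lp2_meas|exact/cmeasJ/Lp2_meas].
apply: aeTS hae => t hz; set z := cis t in hz *.
have -> : e z - b z * e z = (1 - b z) * e z by ring.
have -> : 1 - b z = - a^*%R * (z - a) * \sum_(k < N) (a^*%R * z) ^+ k.
  rewrite /b -opprB subrX1 -mulNr; congr (_ * _).
  by rewrite opprB mulrBr !mulNr opprK [a^*%R * a]mulrC aJ addrC.
have -> : - a^*%R * (z - a) * (\sum_(k < N) (a^*%R * z) ^+ k) * e z =
   - a^*%R * (\sum_(k < N) (a^*%R * z) ^+ k) * ((z - a) * e z) by ring.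
rewrite hz mulr1 rmorphM rmorphN /= conjCK.
by rewrite mulrACA mulrNN [a^*%R * a]mulrC aJ mul1r.
Qed.
End CirclePoles.

(** * Bounded rational functions and their projections *)

Section RationalFunctions.
Context {R : realType}.
Local Notation C := R[i].
Implicit Types f g h b : C -> C.
Local Notation H2 := (Hp 2%:E).

Lemma aeT_neq (a : C) : aeT (fun z => z != a).
Proof.
have [ha|ha] := eqVneq `|a| 1; last first.
  by apply: aeTW => t; rewrite -subr_eq0 cis_subr_neq0.
(* Geometric sums S_N of the powers of z / a satisfy S_N a = N and have squared norm N,
   so an atom of mass I at a forces N^2 I <= N for all N. *)
pose e (z : C) : C := (z == a)%:R.
have he : cbnd e.
  split; last first.
    by exists 1; apply: aeTW => t; rewrite /e; case: eqP; rewrite ?Normc.normc1 ?Normc.normc0.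
  have mA : measurable [set t : measurableTypeR R | cis t = a].
    have -> : [set t : measurableTypeR R | cis t = a] =
        (fun t => cos t) @^-1` [set complex.Re a] `&` (fun t => sin t) @^-1` [set complex.Im a].
      apply/seteqP; split => t /=; first by move=> <-.
      by move=> [h1 h2]; apply/eqP; rewrite eq_complex /= h1 h2 !eqxx.
    by apply: measurableI; apply: closed_measurable; apply: closed_comp;
      [move=> ? _; exact: continuous_cos|exact: closed_eq|move=> ? _; exact: continuous_sin|exact: closed_eq].
  split.
  - rewrite (_ : (fun _ => _) = \1_[set t : measurableTypeR R | cis t = a]).
      exact: measurable_indic.
    apply/funext => t; rewrite /e indicE; case: eqP => h; first by rewrite mem_set.
    by rewrite memNset.
  - rewrite (_ : (fun _ => _) = cst 0); first exact: measurable_cst.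
    by apply/funext => t; rewrite /e; case: eqP.
have he2 := cbnd_Lp2 he.
pose I := integralT (fun z => e z * (e z)^*%R).
suff I0 : I = 0.
  apply: aeTS (integralT_sqr_eq0 he2 I0) => t; rewrite /e; case: eqP => // _ /eqP.
  by rewrite oner_eq0.
have haJ : `|a^*%R| = 1 by rewrite norm_conjC.
have aJ : a^*%R * a = 1 by rewrite mulrC -normCK ha expr1n.
have h (N : nat) : N%:R * (N%:R * I) <= N%:R.
  rewrite -{3}(integralT_sum_unit N haJ); set S := fun z => \sum_(k < N) (a^*%R * z) ^+ k.
  have hS : cbnd S := cbnd_geom _ N.
  have hS2 := cbnd_Lp2 hS.
  have hD : Lp 2%:E (fun z => S z - e z * S z) by apply: Lp2B => //; exact: cbnd_Lp2M.
  rewrite (_ : integralT _ = N%:R * (N%:R * I) + integralT (fun z => (S z - e z * S z) * (S z - e z * S z)^*%R)).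
    by rewrite lerDl integralT_sqr_ge0.
  rewrite mulrA -natrM -integralTZ; last exact: Lp2_ip.
  rewrite -integralTD; [|exact/cintgZ/Lp2_ip|exact: Lp2_ip].
  apply: integralT_ext => t; rewrite -[\sum_(_ < _) _]/(S (cis t)).
  have [->|ne] := eqVneq (cis t) a.
    have -> : S a = N%:R.
      by rewrite /S (eq_bigr (fun=> 1)) ?sumr_const ?card_ord // => i _; rewrite aJ expr1n.
    have -> : e a = 1 by rewrite /e eqxx.
    by rewrite !mul1r subrr rmorph_nat rmorph1 rmorph0 mulr0 addr0 mulr1 natrM.
  have -> : e (cis t) = 0 by rewrite /e (negbTE ne).
  by rewrite !mul0r mulr0 add0r subr0.
have I_ge0 : 0 <= I by exact: integralT_sqr_ge0.
apply: (@ge0_natbounded _ _ 1) => // -[|N]; first by rewrite mul0r.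
have := h N.+1; rewrite -[X in _ <= X]mulr1 ler_pM2l ?ltr0n //.
Qed.

Lemma aeT_horner_neq0 (p : {poly C}) : p != 0 -> aeT (fun z => p.[z] != 0).
Proof.
move=> p0; have [s ps] := closed_field_poly_normal p.
have : aeT (fun z => z \notin s).
  elim: s {ps} => [|a s IHs]; first exact: aeTW.
  apply: aeTS (aeTI (aeT_neq a) IHs) => t [h1 h2].
  by rewrite inE negb_or h1.
apply: aeTS => t h; rewrite ps hornerZ mulf_neq0 ?lead_coef_eq0 //.
by rewrite -/(root _ _) root_prod_XsubC.
Qed.

Definition circle_free (q : {poly C}) := forall a, `|a| = 1 -> q.[a] != 0.

Lemma circle_free_neq0 q : circle_free q -> q != 0.
Proof. by move=> /(_ 1 (normr1 _)); apply: contra => /eqP ->; rewrite horner0. Qed.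

Lemma circle_free_cis q t : circle_free q -> q.[cis t] != 0.
Proof. by apply; exact: norm_cis. Qed.

Lemma circle_free1 : circle_free 1.
Proof. by move=> a _; rewrite hornerC oner_eq0. Qed.

Lemma circle_freeM p q : circle_free p -> circle_free q -> circle_free (p * q).
Proof. by move=> hp hq a ha; rewrite hornerM mulf_neq0 ?hp ?hq. Qed.

Lemma cbnd_horner (p : {poly C}) : cbnd (horner p).
Proof.
elim/poly_ind: p => [|p c IHp].
  rewrite (_ : horner 0 = fun=> 0); first exact: cbnd_cst.
  by apply/funext => z; rewrite horner0.
rewrite (_ : horner _ = fun z => p.[z] * z + c).
  exact: cbndD (cbndM IHp cbnd_id) (cbnd_cst _).
by apply/funext => z; rewrite hornerMXaddC.
Qed.

Lemma Lp2_horner (p : {poly C}) f : Lp 2%:E f -> Lp 2%:E (fun z => p.[z] * f z).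
Proof. exact: cbnd_Lp2M (cbnd_horner p).
Qed.

(** Induction on the degree of [q]: at a zero [a] of [q] on the circle, either [p] vanishes too and
    a factor cancels, or [F] has a genuine pole at [a], impossible in L^2. *)
Lemma rational_circle_free F (p q : {poly C}) : Lp 2%:E F -> q != 0 ->
  aeT (fun z => q.[z] * F z = p.[z]) ->
  exists p' q', circle_free q' /\ aeT (fun z => q'.[z] * F z = p'.[z]).
Proof.
move=> hF; move: {2}(size q) (leqnn (size q)) p => n; elim: n q => [|n IHn] q.
  by rewrite leqn0 size_poly_eq0 => /eqP -> p; rewrite eqxx.
move=> sq p q0 hq; have [|/existsNP[a /not_implyP[ha /negP]]] := pselect (circle_free q).
  by exists p, q.
rewrite negbK => /factor_theorem[q1 qE].
have q10 : q1 != 0 by apply: contra q0 => /eqP q10; rewrite qE q10 mul0r.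
have sq1 : (size q1 <= n)%N.
  by move: sq; rewrite qE size_Mmonic ?monicXsubC // size_XsubC addn2.
have /factor_theorem[k kE] : root (p - p.[a]%:P) a by rewrite /root !hornerE subrr.
have [pa|pa] := eqVneq p.[a] 0.
  apply: (IHn q1 sq1 k q10).
  apply: aeTS (aeTI hq (aeT_neq a)) => t [+ h].
  move: kE; rewrite pa subr0 qE => ->; rewrite !hornerM hornerXsubC => hh.
  have h' : cis t - a != 0 by rewrite subr_eq0.
  by apply: (mulIf h'); rewrite -hh mulrAC.
(* Since p = k (z - a) + p(a) and q = q1 (z - a), the L^2 function q1 F - k equals p(a) / (z -
   a). *)
exfalso; apply: (@circle_pole_notin_Lp2 _ (fun z => p.[a]^-1 * (q1.[z] * F z - k.[z])) a) => //.
  by apply: Lp2Z; apply: Lp2B; [exact: Lp2_horner|exact/H2_Lp/H2_poly].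
apply: aeTS hq => t hh.
have pE : p.[cis t] = k.[cis t] * (cis t - a) + p.[a].
  by have /eqP := congr1 (horner^~ (cis t)) kE; rewrite !hornerE subr_eq => /eqP.
move: hh; rewrite pE qE hornerM hornerXsubC => hh.
have -> : (cis t - a) * (p.[a]^-1 * (q1.[cis t] * F (cis t) - k.[cis t])) =
  p.[a]^-1 * (q1.[cis t] * (cis t - a) * F (cis t) - k.[cis t] * (cis t - a)) by ring.
by rewrite hh addrAC subrr add0r mulVf.
Qed.

Lemma H2_div_outer (s : seq C) f u : {in s, forall a, 1 < `|a|} -> H2 f -> cmeas u ->
  aeT (fun z => \prod_(a <- s) (z - a) * u z = f z) -> H2 u.
Proof.
elim: s f => [|a s IHs] f hs hf mu hu.
  by apply: H2_ae hf mu _; apply: aeTS hu => t; rewrite big_nil mul1r.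
have ha : 1 < `|a| by apply: hs; rewrite mem_head.
have a0 : a != 0 by rewrite -normr_gt0 (lt_trans ltr01).
have haV : `|a^-1| < 1 by rewrite normfV invf_lt1 // (lt_trans ltr01).
apply: (IHs (fun z => - a^-1 * ((1 - a^-1 * z)^-1 * f z))) => //.
- by move=> b hb; apply: hs; rewrite inE hb orbT.
- exact/H2Z/H2_divout.
apply: aeTS hu => t <-; rewrite big_cons.
have h : cis t - a != 0 by apply: cis_subr_neq0; rewrite gt_eqF.
have -> : 1 - a^-1 * cis t = - a^-1 * (cis t - a) by field.
by move: (cis t) h (\prod_(_ <- _) _) (u _) => z h p v; field; rewrite h a0.
Qed.

Lemma sproj_div_inner (s : seq C) f h u : {in s, forall a, `|a| < 1} ->
  Lp 2%:E f -> sproj f h -> cmeas u ->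
  aeT (fun z => \prod_(a <- s) (z - a) * u z = f z) -> exists k, sproj u k.
Proof.
elim: s f h => [|a s IHs] f h hs hf P mu hu.
  exists h; apply: sproj_ae hf mu _ P; apply: aeTS hu => t.
  by rewrite big_nil mul1r.
have ha : `|a| < 1 by apply: hs; rewrite mem_head.
have ha1 : `|a| != 1 by rewrite lt_eqF.
apply: IHs _ (cbnd_Lp2M (cbnd_inv ha1) hf) (sproj_divin ha hf P) mu _.
- by move=> b hb; apply: hs; rewrite inE hb orbT.
- by apply: aeTS hu => t <-; rewrite big_cons mulrA mulrA mulVf ?mul1r ?cis_subr_neq0.
Qed.

(** The roots of [q] outside the disc are divided out first, which stays in H^2; the remaining ones
    lie inside and are handled one at a time by [sproj_divin]. *)
Lemma sproj_exists (q : {poly C}) f u : circle_free q -> H2 f -> cmeas u ->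
  aeT (fun z => q.[z] * u z = f z) -> exists k, sproj u k.
Proof.
move=> hq hf mu hu; have [s qE] := closed_field_poly_normal q.
have hs a : a \in s -> `|a| != 1.
  move=> ha; apply/eqP => /hq; rewrite qE hornerZ mulf_eq0 negb_or => /andP[_].
  by rewrite -/(root _ _) root_prod_XsubC ha.
have c0 : lead_coef q != 0 by rewrite lead_coef_eq0 circle_free_neq0.
pose I := [seq a <- s | `|a| < 1]; pose O := [seq a <- s | ~~ (`|a| < 1)].
have qz z : q.[z] = lead_coef q * (\prod_(a <- I) (z - a) * \prod_(a <- O) (z - a)).
  rewrite {1}qE hornerZ horner_prod (bigID (fun a : C => `|a| < 1)) /= !big_filter.
  by congr (_ * (_ * _)); apply: eq_bigr => a _; rewrite hornerXsubC.
pose v z := \prod_(a <- I) (z - a) * u z.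
have mP l : cbnd (fun z : C => \prod_(a <- l) (z - a)).
  rewrite (_ : (fun _ => _) = horner (\prod_(a <- l) ('X - a%:P))).
    exact: cbnd_horner.
  by apply/funext => z; rewrite horner_prod; apply: eq_bigr => a _; rewrite hornerXsubC.
have hv : H2 v.
  apply: (@H2_div_outer O (fun z => (lead_coef q)^-1 * f z)).
  - move=> a; rewrite mem_filter => /andP[h1 h2].
    by rewrite lt_neqAle eq_sym hs // real_leNgt ?real1 ?normr_real.
  - exact: H2Z.
  - by apply: cmeasM => //; case: (mP I).
  - by apply: aeTS hu => t <-; rewrite qz /v; field.
apply: (@sproj_div_inner I v v) => //.
- by move=> a; rewrite mem_filter => /andP[].
- exact: H2_Lp.
- exact: sproj_H2.
- exact: aeTW.
Qed.
End RationalFunctions.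

(** * Vector-valued functions and their inner product *)

Section VectorFunctions.
Context {R : realType}.
Local Notation C := R[i].
Local Notation VH := (mxHp 2%:E).
Local Notation V2 := (mxLp 2%:E).

Lemma cintg_sum (I : finType) (F : I -> C -> C) : (forall i, cintg (F i)) ->
  cintg (fun z => \sum_i F i z) /\ integralT (fun z => \sum_i F i z) = \sum_i integralT (F i).
Proof.
move=> hF; pose P (G : C -> C) (x : C) := cintg G /\ integralT G = x.
suff : P (fun z => \sum_i F i z) (\sum_i integralT (F i)) by [].
rewrite (_ : (fun _ => _) = fun z => \sum_(i <- enum I) F i z); last first.
  by apply/funext => z; rewrite big_enum.
rewrite -big_enum /=; elim: (enum I) => [|i s [IH1 IH2]].
  rewrite big_nil; under eq_fun do rewrite big_nil.
  by split; [exact/cintg_cbnd/cbnd_cst|exact: integralT_cst].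
rewrite big_cons; under eq_fun do rewrite big_cons.
by split; [exact: cintgD|rewrite integralTD // IH2].
Qed.

Lemma VH_V2 n m (f : C -> 'M[C]_(n, m)) : VH f -> V2 f.
Proof. by move=> hf i j; exact/H2_Lp/hf. Qed.

Definition mxmeas n m (F : C -> 'M[C]_(n, m)) := forall i j, cmeas (fun z => F z i j).
Definition mxbnd n m (F : C -> 'M[C]_(n, m)) := forall i j, cbnd (fun z => F z i j).

Lemma V2_meas n m (f : C -> 'M[C]_(n, m)) : V2 f -> mxmeas f.
Proof. by move=> hf i j; exact/Lp2_meas/hf. Qed.

Lemma V2D n m (f g : C -> 'M[C]_(n, m)) : V2 f -> V2 g -> V2 (fun z => f z + g z).
Proof. by move=> hf hg i j; under eq_fun do rewrite mxE; exact: Lp2D. Qed.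

Lemma V2Z n m c (f : C -> 'M[C]_(n, m)) : V2 f -> V2 (fun z => c *: f z).
Proof. by move=> hf i j; under eq_fun do rewrite mxE; exact: Lp2Z. Qed.

Lemma V2B n m (f g : C -> 'M[C]_(n, m)) : V2 f -> V2 g -> V2 (fun z => f z - g z).
Proof. by move=> hf hg i j; under eq_fun do rewrite !mxE; exact: Lp2B. Qed.

Lemma VHD n m (f g : C -> 'M[C]_(n, m)) : VH f -> VH g -> VH (fun z => f z + g z).
Proof. by move=> hf hg i j; under eq_fun do rewrite mxE; exact: H2D. Qed.

Lemma VHZ n m c (f : C -> 'M[C]_(n, m)) : VH f -> VH (fun z => c *: f z).
Proof. by move=> hf i j; under eq_fun do rewrite mxE; exact: H2Z. Qed.

Lemma VHB n m (f g : C -> 'M[C]_(n, m)) : VH f -> VH g -> VH (fun z => f z - g z).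
Proof. by move=> hf hg i j; under eq_fun do rewrite !mxE; exact: H2B. Qed.

Lemma VH0 n m : VH (fun=> 0 : 'M[C]_(n, m)).
Proof. by move=> i j; under eq_fun do rewrite mxE; exact: H2_cst. Qed.

Lemma VH_ae n m (f g : C -> 'M[C]_(n, m)) : VH f -> mxmeas g -> aeT (fun z => f z = g z) -> VH g.
Proof. by move=> hf mg fg i j; apply: H2_ae (hf i j) (mg i j) _; apply: aeTS fg => t ->. Qed.

Lemma Lp2_sum (I : finType) (F : I -> C -> C) : (forall i, Lp 2%:E (F i)) ->
  Lp 2%:E (fun z => \sum_i F i z).
Proof.
move=> hF; rewrite (_ : (fun _ => _) = fun z => \sum_(i <- enum I) F i z); last first.
  by apply/funext => z; rewrite big_enum.
elim: (enum I) => [|i s IH]; first by under eq_fun do rewrite big_nil; exact: Lp2_cst.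
by under eq_fun do rewrite big_cons; exact: Lp2D.
Qed.

Lemma V2M n m k (A : C -> 'M[C]_(n, m)) (f : C -> 'M[C]_(m, k)) :
  mxbnd A -> V2 f -> V2 (fun z => A z *m f z).
Proof.
move=> hA hf i j; under eq_fun do rewrite mxE.
by apply: Lp2_sum => l; apply: cbnd_Lp2M.
Qed.

Lemma mxbndJ n m (A : C -> 'M[C]_(n, m)) : mxbnd A -> mxbnd (fun z => (A z)^t*).
Proof. by move=> hA i j; under eq_fun do rewrite !mxE; exact: cbndJ. Qed.

Lemma innerE n (f g : C -> 'cV[C]_n) : V2 f -> V2 g ->
  cintg (fun z => \sum_(i < n) f z i 0 * (g z i 0)^*%R) /\
  inner f g = \sum_(i < n) integralT (fun z => f z i 0 * (g z i 0)^*%R).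
Proof. by move=> hf hg; apply: (@cintg_sum 'I_n) => i; exact: Lp2_ip. Qed.

Lemma innerDl n (f g h : C -> 'cV[C]_n) : V2 f -> V2 g -> V2 h ->
  inner (fun z => f z + g z) h = inner f h + inner g h.
Proof.
move=> hf hg hh; rewrite -integralTD; [|exact: (innerE hf hh).1|exact: (innerE hg hh).1].
apply: integralT_ext => t; rewrite -big_split; apply: eq_bigr => i _.
by rewrite mxE mulrDl.
Qed.

Lemma innerZl n c (f h : C -> 'cV[C]_n) : V2 f -> V2 h ->
  inner (fun z => c *: f z) h = c * inner f h.
Proof.
move=> hf hh; rewrite -integralTZ; [|exact: (innerE hf hh).1].
apply: integralT_ext => t; rewrite mulr_sumr; apply: eq_bigr => i _.
by rewrite mxE mulrA.
Qed.

Lemma innerJ n (f g : C -> 'cV[C]_n) : V2 f -> V2 g -> (inner f g)^*%R = inner g f.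
Proof.
move=> hf hg; rewrite -integralTJ; [|exact: (innerE hf hg).1].
apply: integralT_ext => t; rewrite rmorph_sum; apply: eq_bigr => i _.
by rewrite rmorphM /= conjCK mulrC.
Qed.

Lemma innerBl n (f g h : C -> 'cV[C]_n) : V2 f -> V2 g -> V2 h ->
  inner (fun z => f z - g z) h = inner f h - inner g h.
Proof.
move=> hf hg hh; rewrite -mulN1r -(innerZl (-1) hg hh) -(innerDl hf (V2Z (-1) hg) hh).
by apply: integralT_ext => t; apply: eq_bigr => i _; rewrite scaleN1r.
Qed.

Lemma innerDr n (f g h : C -> 'cV[C]_n) : V2 f -> V2 g -> V2 h ->
  inner h (fun z => f z + g z) = inner h f + inner h g.
Proof.
move=> hf hg hh; rewrite -innerJ ?innerDl ?rmorphD /= ?innerJ //; exact: V2D.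
Qed.

Lemma innerBr n (f g h : C -> 'cV[C]_n) : V2 f -> V2 g -> V2 h ->
  inner h (fun z => f z - g z) = inner h f - inner h g.
Proof.
move=> hf hg hh; rewrite -innerJ ?innerBl ?rmorphB /= ?innerJ //; exact: V2B.
Qed.

Lemma inner_ae n (f g f' g' : C -> 'cV[C]_n) : V2 f -> V2 g -> V2 f' -> V2 g' ->
  aeT (fun z => f z = f' z) -> aeT (fun z => g z = g' z) -> inner f g = inner f' g'.
Proof.
move=> hf hg hf' hg' ff gg; apply: integralT_ae.
- exact/cintg_meas/(innerE hf hg).1.
- exact/cintg_meas/(innerE hf' hg').1.
- by apply: aeTS (aeTI ff gg) => t [-> ->].
Qed.

Lemma inner_ge0 n (f : C -> 'cV[C]_n) : V2 f -> 0 <= inner f f.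
Proof.
move=> hf; rewrite (innerE hf hf).2; apply: sumr_ge0 => i _; exact: integralT_sqr_ge0.
Qed.

Lemma aeT_all (I : finType) (P : I -> C -> Prop) : (forall i, aeT (P i)) -> aeT (fun z => forall i, P i z).
Proof.
move=> hP; suff : aeT (fun z => forall i, i \in enum I -> P i z).
  by apply: aeTS => t h i; apply: h; rewrite mem_enum.
elim: (enum I) => [|i s IH]; first exact: aeTW.
apply: aeTS (aeTI (hP i) IH) => t [h1 h2] j; rewrite inE => /orP[/eqP -> //|]; exact: h2.
Qed.

Lemma inner_eq0 n (f : C -> 'cV[C]_n) : V2 f -> inner f f = 0 -> aeT (fun z => f z = 0).
Proof.
move=> hf; rewrite (innerE hf hf).2 => /eqP; rewrite psumr_eq0; last first.
  by move=> i _; exact: integralT_sqr_ge0.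
move=> /allP h.
have : aeT (fun z => forall i, f z i 0 = 0).
  apply: aeT_all => i; apply: integralT_sqr_eq0 => //.
  by have /eqP := h i (mem_index_enum i).
by apply: aeTS => t h'; apply/matrixP => i j; rewrite ord1 h' mxE.
Qed.

Lemma inner_adj n (A : C -> 'M[C]_n) (f g : C -> 'cV[C]_n) :
  inner (fun z => A z *m f z) g = inner f (fun z => (A z)^t* *m g z).
Proof.
apply: integralT_ext => t.
under eq_bigr do rewrite mxE mulr_suml.
under [RHS]eq_bigr do rewrite mxE rmorph_sum mulr_sumr.
rewrite exchange_big; apply: eq_bigr => i _; apply: eq_bigr => j _.
by rewrite rmorphM !mxE /= conjCK; ring.
Qed.

(** The condition from which [Pn] chooses: [Pn f] is the default 0 unless some [h] satisfies it. *)
Definition isproj n (f h : C -> 'cV[C]_n) :=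
  VH h /\ forall g, VH g -> inner (fun z => f z - h z) g = 0.

Lemma Pn_VH n (f : C -> 'cV[C]_n) : VH (Pn f).
Proof. by rewrite /Pn; case: xgetP => [h _ []|_]; [|exact: VH0]. Qed.

Lemma Pn_isproj n (f h : C -> 'cV[C]_n) : isproj f h -> isproj f (Pn f).
Proof. by move=> hp; rewrite /Pn; exact: (xgetI _ hp). Qed.

Lemma isproj_inner n (f h g : C -> 'cV[C]_n) : V2 f -> isproj f h -> VH g -> inner f g = inner h g.
Proof.
move=> hf [H P] hg; have := P g hg; rewrite innerBl; try exact: VH_V2; last by [].
by move=> /eqP; rewrite subr_eq0 => /eqP.
Qed.

Lemma isproj_norm n (f h : C -> 'cV[C]_n) : V2 f -> isproj f h ->
  inner f f = inner h h + inner (fun z => f z - h z) (fun z => f z - h z).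
Proof.
move=> hf hp; have H := VH_V2 hp.1; have e1 := isproj_inner hf hp hp.1.
have e2 : inner h f = inner h h by rewrite -(innerJ hf H) e1 innerJ.
by rewrite innerBr ?innerBl ?e1 ?e2 //; [ring|exact: V2B].
Qed.

Lemma isproj_sproj n (f : C -> 'cV[C]_n) : V2 f ->
  (forall i, exists h, sproj (fun z => f z i 0) h) -> exists h, isproj f h.
Proof.
move=> hf /choice[h hP]; exists (fun z => \col_i h i z).
have H : VH (fun z => \col_i h i z).
  by move=> i j; under eq_fun do rewrite mxE; case: (hP i).
split=> // g hg; rewrite (innerE (V2B hf (VH_V2 H)) (VH_V2 hg)).2 big1 // => i _.
rewrite -((hP i).2 _ (hg i 0)); apply: integralT_ext => t.
by rewrite !mxE.
Qed.
End VectorFunctions.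

(** The expression is D(u + c g, u + c g) for a form with D(u, u) = 0, d = D(u, g) and e = D(g,
    g). *)
Lemma sesqui_cauchy (R : realType) (d e : R[i]) : 0 <= e ->
  (forall c : R[i], 0 <= c^*%R * d + c * d^*%R + c * c^*%R * e) -> d = 0.
Proof.
move=> e0 h; have s0 : 0 < (1 + e)^-1 by rewrite invr_gt0 ltr_wpDr.
have sr : ((1 + e)^-1)^*%R = (1 + e)^-1 by apply: CrealP; apply: ger0_real; exact: ltW.
(* The minimizing choice is - d / e; the denominator 1 + e also covers e = 0 and leaves - s (1 + s)
   |d|^2 with s = 1 / (1 + e). *)
have := h (- ((1 + e)^-1 * d)); rewrite rmorphN rmorphM /= sr.
set s := (1 + e)^-1 in s0 sr *.
have -> : - (s * d^*%R) * d + - (s * d) * d^*%R + - (s * d) * - (s * d^*%R) * e =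
  - (s * (d * d^*%R) * (1 + (1 - s * e))) by ring.
have se : 1 - s * e = s.
  have e1 : 1 + e != 0 by rewrite gt_eqF // ltr_wpDr.
  by rewrite /s; field.
have s1 : 0 < 1 + s by rewrite addr_gt0.
rewrite se oppr_ge0 -normCK (pmulr_lle0 _ s1) (pmulr_rle0 _ s0) => h'.
by apply/eqP; rewrite -normr_eq0 -sqrf_eq0 eq_le h' exprn_ge0.
Qed.

(** * Operators with an adjoint, and the form of the self-commutator *)

Section AdjointPairs.
Context {R : realType} (n : nat).
Local Notation C := R[i].
Local Notation vf := (C -> 'cV[C]_n).
Local Notation VH := (mxHp 2%:E).
Implicit Types (f g h k : vf) (T S : vf -> vf).

(** Operators return chosen representatives, so they are neither pointwise linear nor visibly
    compatible with equality a.e. Both properties follow, weakly, from the existence of an adjoint: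
    see [adj_pair_lin] and [adj_pair_ae]. *)
Definition adj_pair T S := [/\ forall f, VH f -> VH (T f), forall f, VH f -> VH (S f)
  & forall f g, VH f -> VH g -> inner (T f) g = inner f (S g)].

Lemma adj_pair_sym T S : adj_pair T S -> adj_pair S T.
Proof.
move=> [hT hS h]; split=> // f g hf hg.
rewrite -(innerJ (VH_V2 hg) (VH_V2 (hS f hf))) -h //.
by rewrite innerJ //; [exact/VH_V2/hT|exact: VH_V2].
Qed.

Lemma adj_pair_comp T S T' S' : adj_pair T S -> adj_pair T' S' ->
  adj_pair (T \o T') (S' \o S).
Proof.
move=> [hT hS h] [hT' hS' h']; split=> [f hf|f hf|f g hf hg] /=.
- exact/hT/hT'.
- exact/hS'/hS.
- by rewrite h ?h' //; [exact: hS|exact: hT'].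
Qed.

Lemma inner_VH_eq0 h : VH h -> (forall f, VH f -> inner f h = 0) -> aeT (fun z => h z = 0).
Proof. by move=> hh h0; apply: inner_eq0; [exact: VH_V2|exact: h0]. Qed.

Lemma adjointP T S g : adj_pair T S -> VH g ->
  VH (adjoint T g) /\ aeT (fun z => adjoint T g z = S g z).
Proof.
move=> [hT hS h] hg.
have [HH P] : VH (adjoint T g) /\ forall f, VH f -> inner (T f) g = inner f (adjoint T g).
  have : [set h | VH h /\ forall f, VH f -> inner (T f) g = inner f h] (S g).
    by split; [exact: hS|move=> f hf; exact: h].
  exact: xgetI.
split=> //; have HB := VHB HH (hS g hg).
have : aeT (fun z => adjoint T g z - S g z = 0).
  apply: inner_VH_eq0 => // f hf.
  by rewrite innerBr -?P -?h ?subrr //; apply: VH_V2 => //; exact: hS.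
by apply: aeTS => t /eqP; rewrite subr_eq0 => /eqP.
Qed.

Lemma adj_pair_ae T S f g : adj_pair T S -> VH f -> VH g -> aeT (fun z => f z = g z) ->
  aeT (fun z => T f z = T g z).
Proof.
move=> hp hf hg fg; have [hT hS h] := hp.
have : aeT (fun z => T f z - T g z = 0).
  apply: inner_VH_eq0 => [|k hk]; first by apply: VHB; exact: hT.
  rewrite innerBr; try exact/VH_V2/hT; last exact: VH_V2.
  apply/eqP; rewrite subr_eq0; apply/eqP.
  have [_ _ h'] := adj_pair_sym hp.
  rewrite -!h' //; apply: inner_ae => //; try exact: VH_V2; try exact/VH_V2/hS.
  exact: aeTW.
by apply: aeTS => t /eqP; rewrite subr_eq0 => /eqP.
Qed.

(** The form D of the overview, for any adjoint pair, so that it also applies to [T \o T] with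
    [S \o S]. *)
Definition sc_form T S f g := inner (T f) (T g) - inner (S f) (S g).

Lemma self_commutatorE T S f g : adj_pair T S -> VH f -> VH g ->
  VH (self_commutator T f) /\ inner (self_commutator T f) g = sc_form T S f g.
Proof.
move=> hp hf hg; have [hT hS h] := hp; have hs := adj_pair_sym hp.
have [A1 A2] := adjointP hp (hT f hf); have [B1 B2] := adjointP hp hf.
split; first by apply: VHB => //; exact: hT.
rewrite innerBl; try exact: VH_V2; last exact/VH_V2/hT.
congr (_ - _).
- rewrite (inner_ae _ _ _ _ A2 (aeTW (fun=> erefl))); try exact: VH_V2; last exact/VH_V2/hS/hT.
  by case: hs => _ _ -> //; exact: hT.
- rewrite h //; apply: inner_ae => //; try exact: VH_V2; try exact/VH_V2/hS.
  exact: aeTW.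
Qed.

Lemma hyponormalP T S : adj_pair T S -> hyponormal T -> forall f, VH f -> 0 <= sc_form T S f f.
Proof. by move=> hp hy f hf; rewrite -(self_commutatorE hp hf hf).2; exact: hy. Qed.

Lemma normal_opP T S : adj_pair T S -> (forall f g, VH f -> VH g -> sc_form T S f g = 0) -> normal_op T.
Proof.
move=> hp h f hf; have [H _] := self_commutatorE hp hf hf.
by apply: inner_eq0; [exact: VH_V2|rewrite (self_commutatorE hp hf H).2; exact: h].
Qed.

Lemma adj_pair_lin T S f g c k : adj_pair T S -> VH f -> VH g -> VH k ->
  inner (T (fun z => f z + c *: g z)) k = inner (T f) k + c * inner (T g) k.
Proof.
move=> [hT hS h] hf hg hk; have hS' := VH_V2 (hS k hk).
have hcg := VHZ c hg.
by rewrite !h ?innerDl ?innerZl //; try exact: VH_V2; exact: VHD.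
Qed.

Lemma adj_pair_linr T S f g c k : adj_pair T S -> VH f -> VH g -> VH k ->
  inner k (T (fun z => f z + c *: g z)) = inner k (T f) + c^*%R * inner k (T g).
Proof.
move=> hp hf hg hk; have [hT hS h] := hp.
have hcg := VHZ c hg.
rewrite -innerJ; [|exact/VH_V2/hT/VHD|exact: VH_V2].
by rewrite (adj_pair_lin c hp) // rmorphD rmorphM /= !innerJ //; try exact: VH_V2; exact/VH_V2/hT.
Qed.

Lemma sc_form_cauchy T S u g : adj_pair T S -> (forall f, VH f -> 0 <= sc_form T S f f) ->
  VH u -> VH g -> sc_form T S u u = 0 -> sc_form T S u g = 0.
Proof.
move=> hp h0 hu hg uu; have [hT hS _] := hp; have hs := adj_pair_sym hp.
apply: (sesqui_cauchy (h0 g hg)) => c.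
have hcg := VHZ c hg; have hug := VHD hu hcg.
have := h0 _ hug; move: uu; rewrite /sc_form.
rewrite (adj_pair_lin c hp) ?(adj_pair_lin c hs) //; try exact: hT; try exact: hS.
rewrite !(adj_pair_linr c hp) ?(adj_pair_linr c hs) //; try exact: hT; try exact: hS.
rewrite rmorphB /= !innerJ; try exact/VH_V2/hT; try exact/VH_V2/hS.
move=> uu; congr (0 <= _).
move/eqP: uu; rewrite subr_eq0 => /eqP ->; ring.
Qed.
End AdjointPairs.

(** * The forms of T and T^2 for a symbol that is normal a.e *)

Section ToeplitzForms.
Context {R : realType} (n : nat).
Local Notation C := R[i].
Local Notation vf := (C -> 'cV[C]_n).
Local Notation VH := (mxHp 2%:E).
Local Notation V2 := (mxLp 2%:E).
Local Notation mf := (C -> 'M[C]_n).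
Implicit Types (f g h k u : vf).

Definition mulmxf (A : mf) (f : vf) : vf := fun z => A z *m f z.

Lemma trCK m p (A : 'M[C]_(m, p)) : (A^t*)^t* = A.
Proof. by apply/matrixP => i j; rewrite !mxE /= conjCK. Qed.

(** By Pythagoras the component orthogonal to H^2 has norm 0. This converts inequalities between
    norms into membership in H^2. *)
Lemma isproj_VH f h : V2 f -> isproj f h -> inner f f <= inner h h -> VH f.
Proof.
move=> hf hp; have hB := V2B hf (VH_V2 hp.1).
rewrite (isproj_norm hf hp) -[leRHS]addr0 lerD2l => h0.
have /(inner_eq0 hB) fh : inner (fun z => f z - h z) (fun z => f z - h z) = 0.
  by apply/eqP; rewrite eq_le h0 inner_ge0.
apply: VH_ae hp.1 (V2_meas hf) _; apply: aeTS fh => t /eqP.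
by rewrite subr_eq0 => /eqP.
Qed.

Variable Phi : mf.
Variable Psi : mf.
Hypothesis PsiE : forall z, Psi z = (Phi z)^t*.
Hypothesis bPhi : mxbnd Phi.
Variables T S : vf -> vf.
Hypothesis T_proj : forall f, VH f -> isproj (mulmxf Phi f) (T f).
Hypothesis S_proj : forall f, VH f -> isproj (mulmxf Psi f) (S f).

Let bPsi : mxbnd Psi.
Proof. by rewrite (_ : Psi = fun z => (Phi z)^t*); [exact: mxbndJ|apply/funext]. Qed.
Let T_VH f (hf : VH f) : VH (T f) := (T_proj hf).1.
Let S_VH f (hf : VH f) : VH (S f) := (S_proj hf).1.

Lemma V2T f : V2 f -> V2 (mulmxf Phi f). Proof. exact: V2M. Qed.

Lemma V2S f : V2 f -> V2 (mulmxf Psi f). Proof. exact: V2M. Qed.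

Lemma inner_Phi f g : inner (mulmxf Phi f) g = inner f (mulmxf Psi g).
Proof.
rewrite /mulmxf inner_adj; apply: integralT_ext => t.
by apply: eq_bigr => i _; rewrite PsiE.
Qed.

Lemma inner_Psi f g : inner (mulmxf Psi f) g = inner f (mulmxf Phi g).
Proof.
rewrite /mulmxf inner_adj; apply: integralT_ext => t.
by apply: eq_bigr => i _; rewrite PsiE trCK.
Qed.

Lemma inner_T f g : VH f -> VH g -> inner (T f) g = inner (mulmxf Phi f) g.
Proof. by move=> hf hg; rewrite (isproj_inner _ (T_proj hf) hg) //; exact/V2T/VH_V2. Qed.

Lemma inner_S f g : VH f -> VH g -> inner (S f) g = inner (mulmxf Psi f) g.
Proof. by move=> hf hg; rewrite (isproj_inner _ (S_proj hf) hg) //; exact/V2S/VH_V2. Qed.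

Lemma adj_pair_TS : adj_pair T S.
Proof.
split=> [f /T_VH//|f /S_VH//|f g hf hg].
have h1 := VH_V2 hf; have h2 := VH_V2 (S_VH hg).
rewrite inner_T // inner_Phi -(innerJ h2 h1) inner_S // innerJ //.
exact/V2S/VH_V2.
Qed.

Lemma TE f : VH f -> VH (mulmxf Phi f) -> aeT (fun z => T f z = Phi z *m f z).
Proof.
move=> hf hPf; have hT := T_VH hf.
have hB := VHB hT hPf.
have : aeT (fun z => T f z - mulmxf Phi f z = 0).
  apply: inner_eq0; first exact: VH_V2.
  by rewrite innerBl ?inner_T ?subrr //; exact: VH_V2.
by apply: aeTS => t /eqP; rewrite subr_eq0 => /eqP.
Qed.

Lemma SE f : VH f -> VH (mulmxf Psi f) -> aeT (fun z => S f z = Psi z *m f z).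
Proof.
move=> hf hPf; have hS := S_VH hf.
have hB := VHB hS hPf.
have : aeT (fun z => S f z - mulmxf Psi f z = 0).
  apply: inner_eq0; first exact: VH_V2.
  by rewrite innerBl ?inner_S ?subrr //; exact: VH_V2.
by apply: aeTS => t /eqP; rewrite subr_eq0 => /eqP.
Qed.

Lemma TEn f : VH f -> VH (mulmxf Phi f) -> inner (T f) (T f) = inner (mulmxf Phi f) (mulmxf Phi f).
Proof.
move=> hf h; have a := VH_V2 h; have b := VH_V2 (T_VH hf).
exact: (inner_ae b b a a (TE hf h) (TE hf h)).
Qed.

Lemma SEn f : VH f -> VH (mulmxf Psi f) -> inner (S f) (S f) = inner (mulmxf Psi f) (mulmxf Psi f).
Proof.
move=> hf h; have a := VH_V2 h; have b := VH_V2 (S_VH hf).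
exact: (inner_ae b b a a (SE hf h) (SE hf h)).
Qed.

Hypothesis D_ge0 : forall f, VH f -> 0 <= sc_form T S f f.

Lemma sc_form_poly f g : VH f -> VH g -> VH (mulmxf Phi f) -> VH (mulmxf Psi f) ->
  VH (mulmxf Phi g) -> VH (mulmxf Psi g) ->
  sc_form T S f g = inner (mulmxf Phi f) (mulmxf Phi g) - inner (mulmxf Psi f) (mulmxf Psi g).
Proof.
move=> hf hg f1 f2 g1 g2; rewrite /sc_form; congr (_ - _).
- by apply: inner_ae; try exact: VH_V2; try exact/VH_V2/T_VH; exact: TE.
- by apply: inner_ae; try exact: VH_V2; try exact/VH_V2/S_VH; exact: SE.
Qed.

Section Normal.
Hypothesis PhiN : aeT (fun z => Phi z *m Psi z = Psi z *m Phi z).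

Lemma inner_PhiPsi f g : V2 f -> V2 g ->
  inner (mulmxf Phi f) (mulmxf Phi g) = inner (mulmxf Psi f) (mulmxf Psi g).
Proof.
move=> hf hg; rewrite -inner_Psi -inner_Phi; apply: inner_ae => //.
- exact/V2S/V2T.
- exact/V2T/V2S.
- by apply: aeTS PhiN => t h; rewrite /mulmxf !mulmxA h.
- exact: aeTW.
Qed.

(** Here S f has the full norm of Psi f, equal to that of Phi f by normality, and D(f, f) >= 0 makes
    T f at least as long. *)
Lemma Phi_VH f : VH f -> VH (mulmxf Psi f) -> VH (mulmxf Phi f).
Proof.
move=> hf hS; have h2 := VH_V2 hf; apply: isproj_VH (T_proj hf) _; first exact: V2T.
have := D_ge0 hf; rewrite subr_ge0; apply: le_trans.
by rewrite (inner_PhiPsi h2 h2) (SEn hf hS).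
Qed.

(** The converse of [Phi_VH] for vectors isotropic for D: then S u is as long as T u = Phi u, hence
    as Psi u. *)
Lemma Psi_VH u : VH u -> VH (mulmxf Phi u) -> sc_form T S u u = 0 -> VH (mulmxf Psi u).
Proof.
move=> hu hT; have h2 := VH_V2 hu; move/eqP; rewrite subr_eq0 => /eqP D0.
apply: isproj_VH (S_proj hu) _; first exact: V2S.
by rewrite -D0 -(inner_PhiPsi h2 h2) (TEn hu hT).
Qed.

Hypothesis Q_ge0 : forall f, VH f -> 0 <= sc_form (T \o T) (S \o S) f f.

(* The form of T^2 vanishes on f, so by Cauchy-Schwarz f is in its kernel; adjunction
   turns this into a statement on the form of T. *)
Lemma kernel_sc_form f : VH f -> VH (mulmxf Psi f) -> VH (mulmxf Psi (mulmxf Psi f)) ->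
  [/\ VH (mulmxf Phi (mulmxf Psi f)), VH (mulmxf Phi (mulmxf Phi f)) &
   forall g, VH g -> sc_form T S (mulmxf Phi (mulmxf Psi f)) g = 0].
Proof.
move=> hf h1 h2; have f2 := VH_V2 hf.
have hu : VH (mulmxf Phi (mulmxf Psi f)) by exact: Phi_VH.
have hP : VH (mulmxf Phi f) by exact: Phi_VH.
have comm k : V2 k -> aeT (fun z => mulmxf Phi (mulmxf Psi k) z = mulmxf Psi (mulmxf Phi k) z).
  by move=> _; apply: aeTS PhiN => t h; rewrite /mulmxf !mulmxA h.
have hSP : VH (mulmxf Psi (mulmxf Phi f)).
  by apply: VH_ae hu _ (comm _ f2); exact/V2_meas/V2S/V2T.
have hPP : VH (mulmxf Phi (mulmxf Phi f)) by exact: Phi_VH.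
split=> // g hg; set u := mulmxf Phi (mulmxf Psi f).
have hp := adj_pair_TS; have [hT hS _] := hp.
have hpp := adj_pair_comp hp hp.
have TT : aeT (fun z => T (T f) z = mulmxf Phi (mulmxf Phi f) z).
  apply: aeTS (aeTI (adj_pair_ae hp (hT f hf) hP (TE hf hP)) (TE hP hPP)) => t [-> //].
have SS : aeT (fun z => S (S f) z = mulmxf Psi (mulmxf Psi f) z).
  apply: aeTS (aeTI (adj_pair_ae (adj_pair_sym hp) (hS f hf) h1 (SE hf h1)) (SE h1 h2)) => t [-> //].
have ae_refl k : aeT (fun z => k z = k z) by exact: aeTW.
have vPP := VH_V2 hPP; have vSS := VH_V2 h2.
have vTT := VH_V2 (hT _ (hT _ hf)); have vS2 := VH_V2 (hS _ (hS _ hf)).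
have vTg := VH_V2 (hT _ hg); have vSg := VH_V2 (hS _ hg).
have vTTg := VH_V2 (hT _ (hT _ hg)); have vSSg := VH_V2 (hS _ (hS _ hg)).
have vu := VH_V2 hu; have vSP := VH_V2 hSP; have vP := VH_V2 hP; have vS := VH_V2 h1.
have uE : inner (mulmxf Phi (mulmxf Phi f)) (mulmxf Phi (mulmxf Phi f)) =
    inner (mulmxf Psi (mulmxf Psi f)) (mulmxf Psi (mulmxf Psi f)).
  rewrite (inner_PhiPsi vP vP) -(inner_ae vu vu vSP vSP (comm f f2) (comm f f2)).
  by rewrite (inner_PhiPsi vS vS).
have Q0 : sc_form (T \o T) (S \o S) f f = 0.
  rewrite /sc_form /= (inner_ae vTT vTT vPP vPP TT TT) (inner_ae vS2 vS2 vSS vSS SS SS).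
  by rewrite uE subrr.
have := sc_form_cauchy hpp Q_ge0 hf hg Q0; rewrite /sc_form /=.
rewrite (inner_ae vTT vTTg vPP vTTg TT (ae_refl _)) (inner_ae vS2 vSSg vSS vSSg SS (ae_refl _)).
(* With u = Phi Psi f, <T^2 f, T^2 g> becomes <Psi Phi^2 f, T g> once one factor is moved to the
   left, and normality identifies Psi Phi^2 f with Phi u; symmetrically for S and Psi u. *)
have ET : aeT (fun z => mulmxf Phi u z = mulmxf Psi (mulmxf Phi (mulmxf Phi f)) z).
  apply: aeTS PhiN => t h; rewrite /u /mulmxf.
  by rewrite [in RHS]mulmxA -h -mulmxA [X in _ = _ *m X]mulmxA -h -mulmxA.
have ES : aeT (fun z => mulmxf Psi u z = mulmxf Phi (mulmxf Psi (mulmxf Psi f)) z).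
  apply: aeTS PhiN => t h; rewrite /u /mulmxf.
  by rewrite [in LHS]mulmxA -h -mulmxA.
move=> <-; congr (_ - _).
- rewrite -(innerJ vTTg vPP) (inner_T (hT g hg) hPP) (innerJ (V2T vTg) vPP).
  rewrite -inner_Psi (inner_T hu (hT g hg)).
  exact: (inner_ae (V2T vu) vTg (V2S vPP) vTg ET (ae_refl (T g))).
- rewrite -(innerJ vSSg vSS) (inner_S (hS g hg) h2) (innerJ (V2S vSg) vSS).
  rewrite -inner_Phi (inner_S hu (hS g hg)).
  exact: (inner_ae (V2S vu) vSg (V2T vSS) vSg ES (ae_refl (S g))).
Qed.
End Normal.
End ToeplitzForms.

(** * Rational symbols as polynomial matrices over a denominator *)

Section PolynomialMatrices.
Context {R : realType}.
Local Notation C := R[i].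
Local Notation VH := (mxHp 2%:E).
Local Notation V2 := (mxLp 2%:E).

Definition evmx m n (Y : 'M[{poly C}]_(m, n)) (z : C) : 'M[C]_(m, n) := map_mx (horner_eval z) Y.

Lemma evmxE m n (Y : 'M[{poly C}]_(m, n)) z i j : evmx Y z i j = (Y i j).[z].
Proof. by rewrite mxE. Qed.

Lemma evmxM m n p (Y : 'M[{poly C}]_(m, n)) (X : 'M[{poly C}]_(n, p)) z : evmx (Y *m X) z = evmx Y z *m evmx X z.
Proof. exact: map_mxM. Qed.

Lemma evmxZ m n (p : {poly C}) (Y : 'M[{poly C}]_(m, n)) z : evmx (p *: Y) z = p.[z] *: evmx Y z.
Proof. exact: map_mxZ. Qed.

Lemma evmx_scalar n (p : {poly C}) z : evmx (p%:M : 'M[{poly C}]_n) z = (p.[z])%:M.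
Proof. exact: map_scalar_mx. Qed.

Lemma evmxB m n (Y X : 'M[{poly C}]_(m, n)) z : evmx (Y - X) z = evmx Y z - evmx X z.
Proof. exact: map_mxB. Qed.

Lemma evmx_col m n (Y : 'M[{poly C}]_(m, n)) j z : evmx (col j Y) z = col j (evmx Y z).
Proof. exact: map_col. Qed.

Lemma VH_evmx m n (Y : 'M[{poly C}]_(m, n)) : VH (evmx Y).
Proof. by move=> i j; under eq_fun do rewrite evmxE; exact: H2_poly. Qed.

Lemma evmx_ae_eq0 m n (Y : 'M[{poly C}]_(m, n)) : aeT (fun z => evmx Y z = 0) -> Y = 0.
Proof.
move=> h; apply/matrixP => i j; rewrite mxE; apply: poly_ae_eq0; apply: aeTS h => t.
by move/matrixP/(_ i j); rewrite evmxE mxE.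
Qed.

Definition circ_rep m n (Phi : C -> 'M[C]_(m, n)) (s : {poly C}) (Y : 'M[{poly C}]_(m, n)) :=
  circle_free s /\ aeT (fun z => s.[z] *: Phi z = evmx Y z).

Lemma H2_sum (I : finType) (F : I -> C -> C) : (forall i, Hp 2%:E (F i)) ->
  Hp 2%:E (fun z => \sum_i F i z).
Proof.
move=> hF; rewrite (_ : (fun _ => _) = fun z => \sum_(i <- enum I) F i z); last first.
  by apply/funext => z; rewrite big_enum.
elim: (enum I) => [|i s IH]; first by under eq_fun do rewrite big_nil; exact: H2_cst.
by under eq_fun do rewrite big_cons; exact: H2D.
Qed.

Lemma VH_evmxM m n k (Y : 'M[{poly C}]_(m, n)) (f : C -> 'M[C]_(n, k)) : VH f -> VH (fun z => evmx Y z *m f z).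
Proof.
move=> hf i j; under eq_fun do rewrite mxE; apply: H2_sum => l.
by under eq_fun do rewrite evmxE; exact: H2_horner.
Qed.

(** Phi f is the H^2 function Y f divided by [s], so each entry has a projection by [sproj_exists],
    and the choice made in [Pn] is a genuine one. *)
Lemma circ_rep_proj n (Phi : C -> 'M[C]_n) s Y : mxbnd Phi -> circ_rep Phi s Y ->
  forall f : C -> 'cV[C]_n, VH f -> isproj (mulmxf Phi f) (Toeplitz Phi f).
Proof.
move=> bP [hs hY] f hf; suff [h] : exists h, isproj (mulmxf Phi f) h by exact: Pn_isproj.
have hPf : V2 (mulmxf Phi f) by apply: V2M => //; exact: VH_V2.
apply: isproj_sproj => // i.
apply: (@sproj_exists _ s (fun z => (evmx Y z *m f z) i 0)) => //.
- exact: (VH_evmxM Y hf).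
- exact: (V2_meas hPf i 0).
by apply: aeTS hY => t <-; rewrite -scalemxAl [RHS]mxE.
Qed.

(** The reciprocal polynomial: for [p] of degree at most N it is z^N times the conjugate of p(1 /
    conj z), which on the circle is z^N times the conjugate of p(z). *)
Definition revp N (p : {poly C}) : {poly C} := \poly_(i < N.+1) (p`_(N - i))^*%R.

Lemma revpE N (p : {poly C}) t : (size p <= N.+1)%N -> (revp N p).[cis t] = cis t ^+ N * (p.[cis t])^*%R.
Proof.
move=> sp; rewrite horner_poly (horner_coef_wide _ sp) rmorph_sum mulr_sumr.
rewrite (reindex_inj rev_ord_inj) /=; apply: eq_bigr => i _.
have iN : (i <= N)%N by rewrite -ltnS.
rewrite subSS subKn // rmorphM rmorphXn /= cisJ mulrCA; congr (_ * _).
by rewrite exprVn -exprB ?unitfE ?cis_neq0.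
Qed.

Lemma circ_repJ n (Phi : C -> 'M[C]_n) s Y : circ_rep Phi s Y ->
  exists s' Y', circ_rep (fun z => (Phi z)^t*) s' Y'.
Proof.
move=> [hs hY].
(* One N for the denominator and all entries, so that the factor z^N is common to both sides. *)
pose N := maxn (size s) (\max_i \max_j size (Y i j)).
have szs : (size s <= N.+1)%N by apply: leqW; exact: leq_maxl.
have szY i j : (size (Y i j) <= N.+1)%N.
  apply: leqW; apply: leq_trans (leq_maxr _ _).
  apply: leq_trans (leq_bigmax (F := fun i => \max_j size (Y i j)) i).
  exact: (leq_bigmax (F := fun j => size (Y i j)) j).
exists (revp N s), (\matrix_(i, j) revp N (Y j i)); split.
  (* [revpE] speaks of points [cis t] only; a unimodular [a] is [cis t] with t = acos (Re a), up to
     the sign given by Im a. *)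
  move=> a ha; have [t ->] : exists t, a = cis t.
    have := add_Re2_Im2 a; rewrite ha expr1n; case: (a) => x y /= [xy].
    have x1 : -1 <= x <= 1.
      by rewrite -ler_norml -(@ler_pXn2r _ 2) ?nnegrE // expr1n real_normK ?num_real // -xy lerDl sqr_ge0.
    have sE : sin (acos x) = `|y|.
      by rewrite sin_acos //; rewrite -xy addrAC subrr add0r sqrtr_sqr.
    have cE : cos (acos x) = x by rewrite acosK // in_itv.
    have [y0|y0] := leP 0 y.
      by exists (acos x); rewrite /cis cE sE ger0_norm.
    by exists (- acos x); rewrite /cis cosN sinN cE sE ltr0_norm // opprK.
  rewrite revpE //.
  by rewrite mulf_neq0 ?expf_neq0 ?cis_neq0 // conjC_eq0 circle_free_cis.
apply: aeTS hY => t h; apply/matrixP => i j; rewrite evmxE !mxE /=.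
rewrite !revpE //.
rewrite -mulrA -rmorphM; congr (_ * (_)^*%R).
by move/matrixP: h => /(_ j i); rewrite evmxE mxE.
Qed.

(** Each entry is bounded, hence in L^2, so [rational_circle_free] clears its denominator of zeros
    on the circle; the product of these denominators is common to all entries. *)
Lemma circ_rep_of n (Phi : C -> 'M[C]_n) : mxLp +oo%E Phi -> rational_mx Phi ->
  mxbnd Phi /\ exists s Y, circ_rep Phi s Y.
Proof.
move=> hL hR; have bP : mxbnd Phi by move=> i j; exact/LpooP/hL.
split=> //.
have h (ij : 'I_n * 'I_n) : exists pq : {poly C} * {poly C}, circle_free pq.2 /\
    aeT (fun z => pq.2.[z] * Phi z ij.1 ij.2 = pq.1.[z]).
  have [p [q [q0 hq]]] := hR ij.1 ij.2.
  have [p' [q' [h1 h2]]] : exists p' q', circle_free q' /\ aeT (fun z => q'.[z] * Phi z ij.1 ij.2 = p'.[z]).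
    apply: (@rational_circle_free _ _ p q) => //; first exact/cbnd_Lp2/bP.
    apply: aeTS (aeTI hq (aeT_horner_neq0 q0)) => t [-> qt].
    by rewrite mulrCA mulfV ?mulr1.
  by exists (p', q').
have [r hr] := choice h.
exists (\prod_ij (r ij).2), (\matrix_(i, j) ((r (i, j)).1 * \prod_(kl | kl != (i, j)) (r kl).2)); split.
  by apply: (big_ind circle_free) => [||ij _]; [exact: circle_free1|exact: circle_freeM|case: (hr ij)].
have := @aeT_all _ _ (fun ij z => (r ij).2.[z] * Phi z ij.1 ij.2 = (r ij).1.[z]) (fun ij => (hr ij).2).
apply: aeTS => t ht; apply/matrixP => i j; rewrite evmxE !mxE (bigD1 (i, j)) //= !hornerM -(ht (i, j)) /=.
by rewrite mulrAC.
Qed.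

Lemma normal_of_hyponormal n (Phi : C -> 'M[C]_n) s Y : mxbnd Phi -> circ_rep Phi s Y ->
  forall Psi, (forall z, Psi z = (Phi z)^t*) ->
  (forall f, VH f -> 0 <= sc_form (Toeplitz Phi) (Toeplitz Psi) f f) ->
  aeT (fun z => Phi z *m Psi z = Psi z *m Phi z).
Proof.
move=> bP hY Psi PsiE D0; have [s' [Y' hY']] := circ_repJ hY.
have EPsi : (fun z => (Phi z)^t*) = Psi by apply/funext => z; rewrite PsiE.
rewrite EPsi in hY'.
have bPs : mxbnd Psi by rewrite -EPsi; exact: mxbndJ.
have exP := circ_rep_proj bP hY; have exS := circ_rep_proj bPs hY'.
have [hs sY] := hY; have [hs' sY'] := hY'.
pose d := s * s'; have [K KE] : exists K, K = Y' *m Y - Y *m Y' by exists (Y' *m Y - Y *m Y').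
have hK : aeT (fun z => d.[z] *: (Psi z *m Phi z - Phi z *m Psi z) = evmx K z).
  apply: aeTS (aeTI sY sY') => t [e1 e2].
  rewrite KE evmxB !evmxM -e1 -e2 /d hornerM -!scalemxAl -!scalemxAr !scalerA scalerBr.
  by rewrite [s'.[_] * _]mulrC.
(* d clears the denominators, so the projections in T and T^* act trivially on dh X. *)
pose dh (X : 'cV[{poly C}]_n) := evmx (d *: X).
have vP X : VH (mulmxf Phi (dh X)).
  apply: (@VH_ae _ _ _ (evmx (s' *: (Y *m X)))); first exact: VH_evmx.
    by apply/V2_meas/V2M => //; exact/VH_V2/VH_evmx.
  apply: aeTS sY => t e1; rewrite /mulmxf /dh !evmxZ evmxM -e1 /d hornerM -scalemxAl -scalemxAr !scalerA.
  by rewrite mulrC.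
have vS X : VH (mulmxf Psi (dh X)).
  apply: (@VH_ae _ _ _ (evmx (s *: (Y' *m X)))); first exact: VH_evmx.
    by apply/V2_meas/V2M => //; exact/VH_V2/VH_evmx.
  by apply: aeTS sY' => t e1; rewrite /mulmxf /dh !evmxZ evmxM -e1 /d hornerM -scalemxAl -scalemxAr !scalerA.
have vd X : VH (dh X) by exact: VH_evmx.
have DE X X' : sc_form (Toeplitz Phi) (Toeplitz Psi) (dh X) (dh X') = inner (evmx (K *m X)) (dh X').
  rewrite (sc_form_poly PsiE bP exP exS) // -(inner_Psi PsiE) -(inner_Phi PsiE).
  rewrite -innerBl; try exact/VH_V2/vd.
  - apply: inner_ae (aeTW (fun=> erefl)); try exact/VH_V2/VH_evmx.
      by apply: V2B; apply: V2M => //; exact/VH_V2.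
    apply: aeTS hK => t e; rewrite evmxM -e /mulmxf /dh evmxZ !mulmxA -!scalemxAr -scalerBr -mulmxBl.
    by rewrite -scalemxAl.
  - by apply: V2M => //; exact/VH_V2.
  - by apply: V2M => //; exact/VH_V2.
(* The extra factor [d] makes [K *m e i] equal to d times column i of [K], which is also
   [dh (col i K)]: the Cauchy-Schwarz test below then yields a squared norm. *)
pose e i : 'cV[{poly C}]_n := d *: delta_mx i 0.
have trK : \sum_i K i i = 0.
  by rewrite -/(\tr K) KE linearB /= mxtrace_mulC subrr.
have D1 i : inner (evmx (K *m e i)) (dh (e i)) = integralT (fun z => (K i i).[z] * d.[z] * ((d * d).[z])^*%R).
  apply: integralT_ext => t; rewrite (bigD1 i) //= big1 ?addr0.
    rewrite /dh !evmxE.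
    have -> : (K *m e i) i 0 = K i i * d by rewrite /e -scalemxAr -colE !mxE mulrC.
    have -> : (d *: e i) i 0 = d * d by rewrite /e !mxE !eqxx mulr1.
    by rewrite hornerM.
  by move=> j ji; rewrite /dh /e !evmxE !mxE (negbTE ji) /= !mulr0 horner0 rmorph0 mulr0.
have D1s : \sum_i inner (evmx (K *m e i)) (dh (e i)) = 0.
  under eq_bigr do rewrite D1.
  rewrite -(cintg_sum _).2; last first.
    move=> i; apply: (Lp2_ip (f := fun z => (K i i).[z] * d.[z]) (g := horner (d * d))).
      exact/cbnd_Lp2/cbndM/cbnd_horner/cbnd_horner.
    exact/cbnd_Lp2/cbnd_horner.
  rewrite -[RHS](integralT_cst 0); apply: integralT_ext => t.
  rewrite -!mulr_suml (_ : \sum_i (K i i).[cis t] = 0) ?mul0r //.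
  by have := congr1 (horner^~ (cis t)) trK; rewrite /= horner_sum horner0.
(* The trace only kills the sum over [i]; its terms are nonnegative by hyponormality, so each one
   vanishes. *)
have D2 i : sc_form (Toeplitz Phi) (Toeplitz Psi) (dh (e i)) (dh (e i)) = 0.
  apply/eqP; have : \sum_i sc_form (Toeplitz Phi) (Toeplitz Psi) (dh (e i)) (dh (e i)) == 0.
    by under eq_bigr do rewrite DE; rewrite D1s.
  by rewrite psumr_eq0 => [/allP/(_ i (mem_index_enum i))|j _]; [|exact/D0/vd].
have hp := adj_pair_TS PsiE bP exP exS.
have Kcol i : col i K = 0.
  have dK : aeT (fun z => evmx (d *: col i K) z = 0).
    apply: inner_eq0; first exact/VH_V2/VH_evmx.
    have := sc_form_cauchy hp D0 (vd (e i)) (vd (col i K)) (D2 i).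
    by rewrite DE /e -scalemxAr -colE.
  have /eqP := evmx_ae_eq0 dK; rewrite scalemx_eq0 => /orP[|/eqP //].
  by rewrite mulf_eq0 !(negbTE (circle_free_neq0 _)).
have K0 : K = 0 by apply/matrixP => i j; have /matrixP/(_ i 0) := Kcol j; rewrite !mxE.
apply: aeTS hK => t /eqP; rewrite K0 /evmx map_mx0 scalemx_eq0 subr_eq0.
by rewrite hornerM mulf_eq0 !(negbTE (circle_free_cis _ _)) //= => /eqP.
Qed.
End PolynomialMatrices.

(** * Pole orders of [Phi] and [Psi] at one point of the disc *)

Section LocalPoles.
Context {R : realType}.
Local Notation C := R[i].
Local Notation VH := (mxHp 2%:E).
Variable a : C.
Hypothesis ha : `|a| < 1.
Local Notation x := ('X - a%:P : {poly C}).

Let ha1 : `|a| != 1. Proof. by rewrite lt_eqF. Qed.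

Lemma cis_sub_neq0 t : cis t - a != 0. Proof. exact: cis_subr_neq0. Qed.

(** The bridge from H^2 to algebra: [ev_unique] shows that [p] vanishes at [a], then a factor
    cancels on the circle and the induction continues. *)
Lemma dvdp_XsubC_H2 (p : {poly C}) k (G : C -> C) : Hp 2%:E G ->
  aeT (fun z => p.[z] = (z - a) ^+ k * G z) -> x ^+ k %| p.
Proof.
move=> hG; elim: k p => [|k IHk] p hp; first by rewrite expr0 dvd1p.
have hk j : Hp 2%:E (fun z => (z - a) ^+ j * G z).
  elim: j => [|j IHj]; first by under eq_fun do rewrite expr0 mul1r.
  by under eq_fun do rewrite exprS -mulrA; exact: H2_mul_subr.
have pa : p.[a] = 0.
  rewrite -ev_poly //; apply: (ev_unique ha _ (hk k)); first exact/H2_meas/H2_poly.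
  by apply: aeTS hp => t ->; rewrite add0r exprS mulrA.
have /factor_theorem[q qE] : root p a by rewrite /root pa.
rewrite qE exprSr dvdp_mul2r ?polyXsubC_eq0 //; apply: IHk.
apply: aeTS hp => t; rewrite qE hornerM hornerXsubC exprSr => h.
by apply: (mulIf (cis_sub_neq0 t)); rewrite h; ring.
Qed.

Lemma evmx_dvd m n (K : 'M[{poly C}]_(m, n)) k : (forall i j, x ^+ k %| K i j) ->
  exists K', K = x ^+ k *: K'.
Proof.
move=> h; exists (\matrix_(i, j) (K i j %/ x ^+ k)); apply/matrixP => i j.
by rewrite !mxE mulrC divpK.
Qed.

Lemma hmX_horner t k : (x ^+ k).[cis t] = (cis t - a) ^+ k.
Proof. by rewrite horner_exp hornerXsubC. Qed.

Lemma x_neq0 t k : (x ^+ k).[cis t] != 0.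
Proof. by rewrite hmX_horner expf_neq0 ?cis_sub_neq0. Qed.

Variable n : nat.
Variables Phi Psi : C -> 'M[C]_n.
(** [Phi] has a pole of order [mlt] at [a] with invertible leading coefficient, a multiple of
    [evmx Z a]; [e0] collects the factors of the denominator that do not vanish at [a]. *)
Variables (mlt : nat) (e0 : {poly C}) (Z : 'M[{poly C}]_n).
Hypothesis mlt_gt0 : (0 < mlt)%N.
Hypothesis e0a : e0.[a] != 0.
Hypothesis ZE : aeT (fun z => (e0 * x ^+ mlt).[z] *: Phi z = evmx Z z).
Hypothesis detZ : (\det Z).[a] != 0.
Hypothesis bPhi : mxbnd Phi.
Hypothesis bPsi : mxbnd Psi.
Hypothesis PhiN : aeT (fun z => Phi z *m Psi z = Psi z *m Phi z).

(** An invertible leading coefficient admits no cancellation of poles: multiplying by the adjugate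
    of [Z] gives x^mlt | det Z * K entrywise, and det Z is coprime to x. *)
Lemma dvd_of_Phi_VH m (K : 'M[{poly C}]_(n, m)) : VH (fun z => Phi z *m evmx K z) ->
  exists K', K = x ^+ mlt *: K'.
Proof.
move=> hK; apply: evmx_dvd => i j.
have dZ : x ^+ mlt %| \det Z * K i j.
  apply: (@dvdp_XsubC_H2 _ _ (fun z => (evmx (\adj Z) z *m (e0.[z] *: (Phi z *m evmx K z))) i j)).
    apply: VH_evmxM => i' j'; under eq_fun do rewrite mxE.
    by apply: H2_horner; exact: hK.
  apply: aeTS ZE => t hZ.
  rewrite -hmX_horner -[X in (X).[_] = _](_ : (\adj Z *m (Z *m K)) i j = _); last first.
    by rewrite mulmxA mul_adj_mx mul_scalar_mx mxE.
  rewrite -evmxE !evmxM -hZ hornerM -!scalemxAl -!scalemxAr !mxE.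
  by rewrite [e0.[_] * _]mulrC -mulrA.
move: dZ; rewrite Gauss_dvdpr // coprimep_expl //.
by rewrite coprimep_sym coprimep_XsubC.
Qed.

Variables (s : {poly C}) (Y : 'M[{poly C}]_n).
Hypothesis repPsi : circ_rep Psi s Y.
Hypothesis detY : \det Y != 0.
Hypothesis S1 : forall f : C -> 'cV[C]_n, VH f -> VH (mulmxf Psi f) -> VH (mulmxf Phi f).

Lemma Phi_evmx_VH m (K : 'M[{poly C}]_(n, m)) : VH (fun z => Psi z *m evmx K z) -> VH (fun z => Phi z *m evmx K z).
Proof.
have E (A : C -> 'M[C]_n) i j z : mulmxf A (evmx (col j K)) z i 0 = (A z *m evmx K z) i j.
  by rewrite /mulmxf evmx_col !mxE; apply: eq_bigr => k _; rewrite !mxE.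
move=> h i j; have hc : VH (mulmxf Psi (evmx (col j K))).
  by move=> i' j'; rewrite ord1; under eq_fun do rewrite E; exact: h.
have := S1 (VH_evmx (col j K)) hc i 0.
by under eq_fun do rewrite E.
Qed.

Lemma VH_mulmx_ae m k p (A : C -> 'M[C]_(m, k)) (K : 'M[{poly C}]_(k, p)) (L : 'M[{poly C}]_(m, p)) :
  mxbnd A -> aeT (fun z => A z *m evmx K z = evmx L z) -> VH (fun z => A z *m evmx K z).
Proof.
move=> bA h; apply: (VH_ae (VH_evmx L)); first by apply/V2_meas/V2M => //; exact/VH_V2/VH_evmx.
by apply: aeTS h => t ->.
Qed.

Lemma polyXsubC_split (p : {poly C}) : p != 0 -> exists m q, q.[a] != 0 /\ p = q * x ^+ m.
Proof.
by move=> p0; have [m [q + ->]] := multiplicity_XsubC p a; rewrite p0 /=; exists m, q.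
Qed.

(** The inverse of [Psi] vanishes at [a] to order at least [mlt]. It also writes scalar polynomial
    matrices as Psi F with [F] polynomial, the input needed by [kernel_sc_form]. *)
Lemma Psi_right_inverse : exists e V, e.[a] != 0 /\
  aeT (fun z => Psi z *m evmx (x ^+ mlt *: V) z = (e.[z])%:M).
Proof.
have [hs sY] := repPsi.
(* If Psi V vanishes to order r at a, then Phi V is also holomorphic at a, so that x^mlt
   divides V; cancelling powers of x lowers r, until it is 0. *)
suff P r : (exists e V, e.[a] != 0 /\ aeT (fun z => Psi z *m evmx V z = ((e * x ^+ r).[z])%:M)) ->
  exists e V, e.[a] != 0 /\ aeT (fun z => Psi z *m evmx (x ^+ mlt *: V) z = (e.[z])%:M).
  have [m [q [qa yE]]] := polyXsubC_split detY.
  apply: (P m); exists q, (s *: \adj Y); split=> //; apply: aeTS sY => t h.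
  by rewrite evmxZ -scalemxAr scalemxAl h -evmxM mul_mx_adj yE evmx_scalar.
have [N] := ubnP r; elim: N r => // N IHN r rN [e [V [ea hV]]].
have [V' VE] : exists V', V = x ^+ mlt *: V'.
  apply: dvd_of_Phi_VH; apply: Phi_evmx_VH.
  apply: (VH_mulmx_ae (L := (e * x ^+ r)%:M)) => //.
  by apply: aeTS hV => t ->; rewrite evmx_scalar.
have [r0|r0] := posnP r.
  by exists e, V'; split=> //; rewrite -VE; apply: aeTS hV => t ->; rewrite r0 expr0 mulr1.
(* Truncated subtraction: cancelling x^(min mlt r) leaves the exponents mlt - r on one side and r -
   mlt on the other. *)
apply: (IHN (r - mlt)%N); first by lia.
exists e, (x ^+ (mlt - r) *: V'); split=> //; apply: aeTS hV => t.
rewrite VE !evmxZ => hV; apply: (scalerI (x_neq0 t (minn mlt r))).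
rewrite -scalemxAr scalerA -hornerM -exprD scale_scalar_mx -hornerM mulrCA -exprD.
rewrite (_ : minn mlt r + (mlt - r) = mlt)%N; last by lia.
by rewrite (_ : minn mlt r + (r - mlt) = r)%N ?scalemxAr //; lia.
Qed.

(* The premise expresses that, for u = Phi Psi f in the kernel of D, Phi u in H^2
   implies Psi u in H^2. *)
Lemma Psi_pole_le : (forall F G L M : 'M[{poly C}]_n,
    aeT (fun z => Psi z *m evmx F z = evmx G z) -> aeT (fun z => Psi z *m evmx G z = evmx L z) ->
    aeT (fun z => Phi z *m (Phi z *m evmx G z) = evmx M z) -> VH (fun z => Phi z *m evmx L z)) ->
  exists e X, e.[a] != 0 /\ aeT (fun z => (e * x ^+ mlt).[z] *: Psi z = evmx X z).
Proof.
move=> S23; have [hs sY] := repPsi.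
have [e1 [V [e1a hV]]] := Psi_right_inverse.
suff P r : (exists e X, e.[a] != 0 /\ aeT (fun z => (e * x ^+ (r + mlt)).[z] *: Psi z = evmx X z)) ->
  exists e X, e.[a] != 0 /\ aeT (fun z => (e * x ^+ mlt).[z] *: Psi z = evmx X z).
  have [m [q [qa sE]]] := polyXsubC_split (circle_free_neq0 hs).
  apply: (P m); exists q, (x ^+ mlt *: Y); split=> //; apply: aeTS sY => t h.
  by rewrite evmxZ -h scalerA -hornerM sE exprD; congr (_.[_] *: _); ring.
have [N] := ubnP r; elim: N r => // N IHN r rN [e [X [ea hX]]].
have [r0|r0] := posnP r; first by exists e, X; split=> //; move: hX; rewrite r0.
apply: (IHN (r - mlt)%N); first by lia.
(* r' is the least exponent such that x^(2 mlt + r') clears both Phi^2 and the pole of [Psi], of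
   order at most r + mlt, with x^j to spare. The premise and [dvd_of_Phi_VH] then extract x^mlt from
   L = Psi G, leaving order r' + mlt. *)
set r' := (r - mlt)%N; set j := (mlt + r' - r)%N.
have rE : (mlt + mlt + r' = j + (r + mlt))%N by rewrite /j /r'; lia.
pose F := (e * e0 ^+ 2 * x ^+ (mlt + mlt + r')) *: (x ^+ mlt *: V).
pose G : 'M[{poly C}]_n := (e * e0 ^+ 2 * x ^+ (mlt + mlt + r') * e1)%:M.
pose L := (e1 * e0 ^+ 2 * x ^+ j) *: X.
pose M := (e * e1 * x ^+ r') *: (Z *m Z).
have hL : VH (fun z => Phi z *m evmx L z).
  apply: (S23 F G L M).
  - apply: aeTS hV => t h; rewrite /F evmxZ -scalemxAr h scale_scalar_mx -hornerM.
    by rewrite evmx_scalar.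
  - apply: aeTS hX => t h; rewrite /G /L evmxZ -h evmx_scalar mul_mx_scalar scalerA -hornerM rE.
    by congr (_.[_] *: _); rewrite exprD; ring.
  - apply: aeTS ZE => t h; rewrite /G /M evmx_scalar mul_mx_scalar -scalemxAr evmxZ evmxM -h.
    rewrite -scalemxAl -scalemxAr !scalerA -!hornerM; congr (_.[_] *: _).
    by rewrite !exprD; ring.
have [X' LE] := dvd_of_Phi_VH hL.
exists (e * e1 * e0 ^+ 2), X'; split.
  by rewrite !hornerM !mulf_neq0 // horner_exp expf_neq0.
apply: aeTS hX => t h; apply: (scalerI (x_neq0 t mlt)).
rewrite -evmxZ -LE /L evmxZ -h !scalerA -!hornerM; congr (_.[_] *: _).
transitivity (e * e1 * e0 ^+ 2 * x ^+ (mlt + mlt + r')); first by rewrite !exprD; ring.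
by rewrite rE exprD; ring.
Qed.

End LocalPoles.

(** * Kernel vectors with simple poles force D = 0 *)

Section SimplePole.
Context {R : realType}.
Local Notation C := R[i].
Local Notation VH := (mxHp 2%:E).
Local Notation V2 := (mxLp 2%:E).
Variable a : C.
Hypothesis ha : `|a| < 1.
Let ha1 : `|a| != 1. Proof. by rewrite lt_eqF. Qed.

(** Conjugating, the k-th hypothesis says that J_k, the integral of z^(k+1) W / (1 - conj(a) z), is
    zero; J_k - conj(a) J_{k+1} is the coefficient of W of index -(k + 1). *)
Lemma H2_of_szego (W : C -> C) : Lp 2%:E W ->
  (forall k, integralT (fun z => (z - a)^-1 * (z ^+ k * W z)^*%R) = 0) -> Hp 2%:E W.
Proof.
move=> hW h; split=> // k; have ha' : `|a^*%R| < 1 by rewrite norm_conjC.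
have hk j : Lp 2%:E (fun z => z ^+ j * W z) by exact: (cbnd_Lp2M (cbndX j) hW).
have hJ j : cintg (fun z => (1 - a^*%R * z)^-1 * (z * (z ^+ j * W z))).
  by apply: Lp2M; [exact/cbnd_Lp2/cbnd_invout|exact: (cbnd_Lp2M cbnd_id (hk j))].
have J0 j : integralT (fun z => (1 - a^*%R * z)^-1 * (z * (z ^+ j * W z))) = 0.
  rewrite -[RHS]conjC0 -(h j) -integralTJ; last first.
    by apply: Lp2_ip (hk j); exact/cbnd_Lp2/cbnd_inv.
  by apply: integralT_ext => t; rewrite rmorphM /= conjCK szego_conj //; ring.
rewrite (@integralT_ext _ _ (fun z => (1 - a^*%R * z)^-1 * (z * (z ^+ k * W z)) +
   - a^*%R * ((1 - a^*%R * z)^-1 * (z * (z ^+ k.+1 * W z))))).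
  by rewrite integralTD ?integralTZ ?J0 ?mulr0 ?addr0 //; exact: cintgZ.
move=> t; have := subr_mul_neq0 t ha'; rewrite !exprS.
by move: (cis t) (W _) (cis t ^+ k) => z w p hz; field.
Qed.

Variable n : nat.
Local Notation vf := (C -> 'cV[C]_n).
(** The vectors spanning simple poles at [a]; they are orthogonal to H^2. *)
Definition ke (j : 'I_n) : vf := fun z => (z - a)^-1 *: delta_mx j 0.

Lemma V2_ke j : V2 (ke j).
Proof.
move=> i k; under eq_fun do rewrite !mxE mulrC.
by apply: Lp2Z; exact/cbnd_Lp2/cbnd_inv.
Qed.

Lemma inner_ke j (f : vf) : inner (ke j) f = integralT (fun z => (z - a)^-1 * (f z j 0)^*%R).
Proof.
apply: integralT_ext => t; rewrite (bigD1 j) //= big1 ?addr0 => [|i ij]; rewrite !mxE.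
  by rewrite !eqxx mulr1.
by rewrite (negbTE ij) mulr0 mul0r.
Qed.

Lemma inner_ke_VH j (f : vf) : VH f -> inner (ke j) f = 0.
Proof. by move=> hf; rewrite inner_ke; exact: integral_szego_antiholo. Qed.

Lemma VH_cstM (A : 'M[C]_n) (f : vf) : VH f -> VH (fun z => A *m f z).
Proof.
move=> hf i j; under eq_fun do rewrite mxE; apply: H2_sum => l; exact: H2Z.
Qed.

Lemma mxbnd_cst (A : 'M[C]_n) : mxbnd (fun=> A).
Proof. by move=> i j; exact: cbnd_cst. Qed.

Lemma V2_cstM (A : 'M[C]_n) (f : vf) : V2 f -> V2 (fun z => A *m f z).
Proof. exact: (V2M (mxbnd_cst A)). Qed.

Lemma inner_cstM (A : 'M[C]_n) (f g : vf) :
  inner (fun z => A *m f z) g = inner f (fun z => A^t* *m g z).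
Proof. exact: (inner_adj (fun=> A)). Qed.

Lemma evmx_taylor m k (M : 'M[{poly C}]_(m, k)) :
  exists N, forall z, evmx M z = evmx M a + (z - a) *: evmx N z.
Proof.
have h (ij : 'I_m * 'I_k) : exists q, M ij.1 ij.2 - (M ij.1 ij.2).[a]%:P = q * ('X - a%:P).
  by apply/factor_theorem; rewrite /root !hornerE subrr.
have [q hq] := choice h; exists (\matrix_(i, j) q (i, j)) => z.
apply/matrixP => i j; rewrite !mxE /horner_eval.
have := congr1 (horner^~ z) (hq (i, j)); rewrite /= !hornerE => /eqP.
by rewrite subr_eq addrC mulrC => /eqP.
Qed.

(** [evmx M a] is the residue of A U at [a]; what remains is polynomial. *)
Lemma pole_split (A : C -> 'M[C]_n) (U M N : 'M[{poly C}]_n) :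
  aeT (fun z => (z - a) *: (A z *m evmx U z) = evmx M z) ->
  (forall z, evmx M z = evmx M a + (z - a) *: evmx N z) ->
  forall j, aeT (fun z => mulmxf A (evmx (col j U)) z = evmx M a *m ke j z + evmx (col j N) z).
Proof.
move=> hM hN j; apply: aeTS hM => t h.
have z0 : cis t - a != 0 by exact: cis_subr_neq0.
apply: (scalerI z0); rewrite scalerDr /ke -scalemxAr scalerA mulfV // scale1r -colE.
move: h; rewrite hN => /matrixP h; apply/matrixP => i k; have := h i j.
rewrite !mxE => <-; congr (_ * _); apply: eq_bigr => l _; rewrite !mxE //.
Qed.

(** Only the pole part of A u leaves H^2: it is orthogonal to T g, whereas the polynomial part pairs
    equally with T g and A g. The discrepancy is thus the pole part against A g. *)
Lemma inner_proj_pole (A : C -> 'M[C]_n) (T : vf -> vf) (U M N : 'M[{poly C}]_n) :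
  mxbnd A -> (forall f, VH f -> isproj (mulmxf A f) (T f)) ->
  aeT (fun z => (z - a) *: (A z *m evmx U z) = evmx M z) ->
  (forall z, evmx M z = evmx M a + (z - a) *: evmx N z) ->
  forall j g, VH g -> let u := evmx (col j U) in
  inner (T u) (T g) = inner (mulmxf A u) (mulmxf A g) -
     inner (ke j) (fun z => (evmx M a)^t* *m mulmxf A g z).
Proof.
move=> bA hT hM hN j g hg u; have hu : VH u := VH_evmx _.
have vu : V2 (mulmxf A u) by apply: V2M => //; exact: VH_V2.
have vg : V2 (mulmxf A g) by apply: V2M => //; exact: VH_V2.
have vN : VH (evmx (col j N)) by exact: VH_evmx.
have vk := V2_cstM (evmx M a) (V2_ke j).
have uE := pole_split hM hN j.
have uh h : V2 h -> inner (mulmxf A u) h = inner (fun z => evmx M a *m ke j z) h + inner (evmx (col j N)) h.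
  move=> vh; rewrite -innerDl //; last exact: VH_V2.
  apply: (inner_ae vu vh _ vh uE (aeTW (fun=> erefl))); apply: V2D => //; exact: VH_V2.
have Tg := (hT g hg).1; have vTg := VH_V2 Tg.
rewrite -(isproj_inner vu (hT u hu) Tg) (uh _ vTg) inner_cstM inner_ke_VH; last exact: VH_cstM.
rewrite add0r -(innerJ vTg (VH_V2 vN)) -(isproj_inner vg (hT g hg) vN) (innerJ vg (VH_V2 vN)).
by rewrite (uh _ vg) inner_cstM addrAC subrr add0r.
Qed.

(** The Gram matrix of the kernels is a nonzero multiple of the identity, so these pairings
    determine every entry of [G]. *)
Lemma ke_gram (c := integralT (fun z => (z - a)^-1 * ((z - a)^-1)^*%R)) :
  c != 0 /\ forall (G : 'M[C]_n) j l, inner (ke j) (fun z => G *m ke l z) = (G j l)^*%R * c.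
Proof.
split.
  apply/eqP => c0; have h := integralT_sqr_eq0 (cbnd_Lp2 (cbnd_inv ha1)) c0.
  suff /eqP : (1 : {poly C}) = 0 by rewrite oner_eq0.
  apply: poly_ae_eq0; apply: aeTS h => t /eqP.
  by rewrite invr_eq0 (negbTE (cis_subr_neq0 t ha1)).
move=> G j l; rewrite inner_ke -integralTZ; last first.
  by apply: Lp2_ip; exact/cbnd_Lp2/cbnd_inv.
by apply: integralT_ext => t; rewrite /ke -scalemxAr -colE !mxE rmorphM; ring.
Qed.

(** Q is A1 times the inverse of A2; the Gram identity makes it unitary and also equal to the
    inverse of [A1^t*] times [A2^t*]. *)
Lemma gram_unitary (A1 A2 : 'M[C]_n) : A2 \in unitmx -> A2^t* *m A2 = A1^t* *m A1 ->
  exists Q : 'M[C]_n, Q^t* *m Q = 1%:M /\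
    forall u v : 'cV[C]_n, A2^t* *m u = A1^t* *m v -> v = Q *m u.
Proof.
move=> unitA gram.
have unitAJ (A : 'M[C]_n) : (A^t* \in unitmx) = (A \in unitmx) by rewrite map_unitmx unitmx_tr.
have : A1^t* *m A1 \in unitmx by rewrite -gram unitmx_mul unitAJ unitA.
rewrite unitmx_mul unitAJ andbb => unitA1; have unitA1J := unitA1; rewrite -unitAJ in unitA1J.
have trM (X Z : 'M[C]_n) : (X *m Z)^t* = Z^t* *m X^t* by rewrite trmx_mul map_mxM.
exists (A1 *m invmx A2); split.
  rewrite trM mulmxA -[X in X *m _]mulmxA -gram mulmxA -trM mulmxV // trmx1 map_mx1 mul1mx.
  by rewrite mulmxV.
move=> u v h; have -> : v = invmx (A1^t*) *m (A2^t* *m u) by rewrite h mulmxA mulVmx // mul1mx.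
rewrite mulmxA; congr (_ *m _); rewrite -[LHS]mulmx1 -(mulmxV unitA) mulmxA; congr (_ *m _).
by rewrite -mulmxA gram mulmxA mulVmx // mul1mx.
Qed.

Lemma sc_form_eq0_of_pole (Phi Psi : C -> 'M[C]_n) (T S : vf -> vf) (U M1 M2 : 'M[{poly C}]_n) :
  (forall z, Psi z = (Phi z)^t*) -> mxbnd Phi -> mxbnd Psi ->
  (forall f, VH f -> isproj (mulmxf Phi f) (T f)) ->
  (forall f, VH f -> isproj (mulmxf Psi f) (S f)) ->
  aeT (fun z => Phi z *m Psi z = Psi z *m Phi z) ->
  aeT (fun z => (z - a) *: (Phi z *m evmx U z) = evmx M1 z) ->
  aeT (fun z => (z - a) *: (Psi z *m evmx U z) = evmx M2 z) ->
  evmx M1 a \in unitmx ->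
  (forall j g, VH g -> sc_form T S (evmx (col j U)) g = 0) ->
  forall f, VH f -> sc_form T S f f = 0.
Proof.
move=> PsiE bPhi bPsi hT hS PhiN h1 h2 unitA D0.
have [N1 hN1] := evmx_taylor M1; have [N2 hN2] := evmx_taylor M2.
set A2 := evmx M1 a in unitA; set A1 := evmx M2 a.
have aux (p q r : C) : p - q - (p - r) = r - q by ring.
(* In D(u, g) = 0 the terms <Phi u, Phi g> and <Psi u, Psi g> cancel by normality, and the two pole
   corrections remain. *)
have E j g : VH g -> inner (ke j) (fun z => A2^t* *m mulmxf Phi g z) =
    inner (ke j) (fun z => A1^t* *m mulmxf Psi g z).
  move=> hg; have := D0 j g hg; rewrite /sc_form.
  rewrite (inner_proj_pole bPhi hT h1 hN1 j hg) (inner_proj_pole bPsi hS h2 hN2 j hg).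
  rewrite (inner_PhiPsi PsiE bPhi PhiN (VH_V2 (VH_evmx _)) (VH_V2 hg)).
  by rewrite aux => /eqP; rewrite subr_eq0 => /eqP/esym.
have v1 g : VH g -> V2 (mulmxf Phi g) by move=> hg; apply: V2M => //; exact: VH_V2.
have v2 g : VH g -> V2 (mulmxf Psi g) by move=> hg; apply: V2M => //; exact: VH_V2.
pose W g : vf := fun z => A2^t* *m mulmxf Phi g z - A1^t* *m mulmxf Psi g z.
have vW g : VH g -> V2 (W g) by move=> hg; apply: V2B; apply: V2_cstM; [exact: v1|exact: v2].
have Wke j g : VH g -> inner (ke j) (W g) = 0.
  move=> hg; rewrite innerBr ?E ?subrr //; try exact: V2_ke; apply: V2_cstM; [exact: v1|exact: v2].
(* Multiplication by z^k commutes with the symbols, so applying [Wke] to z^k g gives all the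
   hypotheses of [H2_of_szego]. *)
have hW g : VH g -> VH (W g).
  move=> hg i j; rewrite ord1; apply: H2_of_szego; first exact: vW.
  move=> k; have hgk : VH (fun z => z ^+ k *: g z).
    move=> i' j'; under eq_fun do rewrite mxE -hornerXn; exact: H2_horner.
  rewrite -[RHS](Wke i _ hgk) inner_ke; apply: integralT_ext => t.
  by rewrite /W /mulmxf -!scalemxAr -scalerBr [in RHS]mxE.
have gram : A2^t* *m A2 = A1^t* *m A1.
  have [c0 keG] := ke_gram; apply/matrixP => j l.
  apply: (inv_inj (@conjCK _)); apply: (mulIf c0); rewrite -!keG.
  have H (A : C -> 'M[C]_n) M N : mxbnd A -> aeT (fun z => (z - a) *: (A z *m evmx U z) = evmx M z) ->
     (forall z, evmx M z = evmx M a + (z - a) *: evmx N z) ->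
     inner (ke j) (fun z => (evmx M a)^t* *m mulmxf A (evmx (col l U)) z) =
     inner (ke j) (fun z => (evmx M a)^t* *m evmx M a *m ke l z).
    move=> bA hM hN; have vk := V2_cstM ((evmx M a)^t* *m evmx M a) (V2_ke l).
    have vN : VH (fun z => (evmx M a)^t* *m evmx (col l N) z) by exact/VH_cstM/VH_evmx.
    rewrite -[RHS]addr0 -(inner_ke_VH j vN) -(innerDr vk (VH_V2 vN) (V2_ke j)).
    apply: inner_ae; try exact: V2_ke.
    - by apply: V2_cstM; apply: V2M => //; exact/VH_V2/VH_evmx.
    - exact: (V2D vk (VH_V2 vN)).
    - exact: aeTW.
    - by apply: aeTS (pole_split hM hN l) => t ->; rewrite mulmxDr mulmxA.
  exact: (etrans (esym (H _ _ _ bPhi h1 hN1)) (etrans (E j _ (VH_evmx (col l U))) (H _ _ _ bPsi h2 hN2))).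
move=> g hg; pose al : vf := fun z => mulmxf Phi g z - T g z.
pose be : vf := fun z => mulmxf Psi g z - S g z.
have [Tg orthT] := hT g hg; have [Sg orthS] := hS g hg.
have val : V2 al by apply: V2B; [exact: v1|exact: VH_V2].
have vbe : V2 be by apply: V2B; [exact: v2|exact: VH_V2].
(* This combination lies in H^2, because W g, T g and S g do, and is orthogonal to H^2, because [al]
   and [be] are. *)
have Aab : aeT (fun z => A2^t* *m al z - A1^t* *m be z = 0).
  have vA := V2_cstM (A2^t*) val; have vB := V2_cstM (A1^t*) vbe.
  have hAB : VH (fun z => A2^t* *m al z - A1^t* *m be z).
    apply: (VH_ae (VHB (hW g hg) (VHB (VH_cstM (A2^t*) Tg) (VH_cstM (A1^t*) Sg)))).
      exact: (V2_meas (V2B vA vB)).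
    apply: aeTW => z; rewrite /W /al /be !mulmxBr !opprB addrACA.
    by rewrite [RHS]addrACA [- (A1^t* *m _) + _]addrC.
  apply: inner_eq0; first exact: (V2B vA vB).
  rewrite (innerBl vA vB (VH_V2 hAB)).
  rewrite !inner_cstM (orthT _ (VH_cstM _ hAB)) (orthS _ (VH_cstM _ hAB)) subrr //.
have [Q [QQ QE]] := gram_unitary unitA gram.
have beE : aeT (fun z => be z = Q *m al z).
  by apply: aeTS Aab => t /eqP; rewrite subr_eq0 => /eqP/QE.
have nab : inner be be = inner al al.
  have vQ := V2_cstM Q val.
  rewrite (inner_ae vbe vbe vQ vQ beE beE) inner_cstM; apply: integralT_ext => t.
  by rewrite mulmxA QQ mul1mx.
rewrite /sc_form; have := inner_PhiPsi PsiE bPhi PhiN (VH_V2 hg) (VH_V2 hg).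
rewrite (isproj_norm (v1 g hg) (hT g hg)) (isproj_norm (v2 g hg) (hS g hg)) -/al -/be nab.
by move=> /addIr ->; rewrite subrr.
Qed.
End SimplePole.

(** * From the pole at [a] to the vanishing of D *)

Section LocalToGlobal.
Context {R : realType}.
Local Notation C := R[i].
Local Notation VH := (mxHp 2%:E).
Variable a : C.
Hypothesis ha : `|a| < 1.
Let ha1 : `|a| != 1. Proof. by rewrite lt_eqF. Qed.
Local Notation x := ('X - a%:P : {poly C}).

Section Kernel.
Variable n : nat.
Local Notation vf := (C -> 'cV[C]_n).
Variables (Phi Psi : C -> 'M[C]_n) (T S : vf -> vf).
Hypothesis PsiE : forall z, Psi z = (Phi z)^t*.
Hypothesis bPhi : mxbnd Phi.
Hypothesis T_proj : forall f, VH f -> isproj (mulmxf Phi f) (T f).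
Hypothesis S_proj : forall f, VH f -> isproj (mulmxf Psi f) (S f).
Hypothesis D_ge0 : forall f, VH f -> 0 <= sc_form T S f f.
Hypothesis PhiN : aeT (fun z => Phi z *m Psi z = Psi z *m Phi z).
Hypothesis Q_ge0 : forall f, VH f -> 0 <= sc_form (T \o T) (S \o S) f f.

Let bPsi : mxbnd Psi.
Proof. by rewrite (_ : Psi = fun z => (Phi z)^t*); [exact: mxbndJ|apply/funext]. Qed.

Lemma sc_form_ae u v g : VH u -> VH v -> VH g -> aeT (fun z => u z = v z) ->
  sc_form T S u g = sc_form T S v g.
Proof.
move=> hu hv hg uv; have hp := adj_pair_TS PsiE bPhi T_proj S_proj; have [hT hS _] := hp.
rewrite /sc_form; congr (_ - _).
- exact: (inner_ae (VH_V2 (hT u hu)) (VH_V2 (hT g hg)) (VH_V2 (hT v hv)) (VH_V2 (hT g hg))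
    (adj_pair_ae hp hu hv uv) (aeTW (fun=> erefl))).
- exact: (inner_ae (VH_V2 (hS u hu)) (VH_V2 (hS g hg)) (VH_V2 (hS v hv)) (VH_V2 (hS g hg))
    (adj_pair_ae (adj_pair_sym hp) hu hv uv) (aeTW (fun=> erefl))).
Qed.

Lemma kernel_poly (f g l : 'cV[{poly C}]_n) :
  aeT (fun z => Psi z *m evmx f z = evmx g z) -> aeT (fun z => Psi z *m evmx g z = evmx l z) ->
  VH (mulmxf Phi (evmx g)) /\ forall h, VH h -> sc_form T S (mulmxf Phi (evmx g)) h = 0.
Proof.
move=> h1 h2; have hf := VH_evmx f; have hg := VH_evmx g.
have v1 : VH (mulmxf Psi (evmx f)) by exact: (VH_mulmx_ae bPsi h1).
have e2 : aeT (fun z => evmx l z = mulmxf Psi (mulmxf Psi (evmx f)) z).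
  by apply: aeTS (aeTI h1 h2) => t [e1 <-]; rewrite /mulmxf e1.
have v2 : VH (mulmxf Psi (mulmxf Psi (evmx f))).
  by apply: (VH_ae (VH_evmx l) _ e2); exact: (V2_meas (V2M bPsi (VH_V2 v1))).
have [k1 _ k3] := kernel_sc_form PsiE bPhi T_proj S_proj D_ge0 PhiN Q_ge0 hf v1 v2.
have e3 : aeT (fun z => mulmxf Phi (mulmxf Psi (evmx f)) z = mulmxf Phi (evmx g) z).
  by apply: aeTS h1 => t e; rewrite /mulmxf e.
have vg : VH (mulmxf Phi (evmx g)).
  by apply: (VH_ae k1 _ e3); exact: (V2_meas (V2M bPhi (VH_V2 hg))).
split; [exact: vg|move=> h hh; rewrite -(sc_form_ae k1 vg hh e3); exact: k3].
Qed.

Lemma col_ae m (A : C -> 'M[C]_n) (F G : 'M[{poly C}]_(n, m)) j :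
  aeT (fun z => A z *m evmx F z = evmx G z) -> aeT (fun z => A z *m evmx (col j F) z = evmx (col j G) z).
Proof.
apply: aeTS => t /matrixP e; apply/matrixP => i k; have := e i j; rewrite !mxE => <-.
by apply: eq_bigr => l _; rewrite !mxE.
Qed.

(** This discharges the premise of [Psi_pole_le]: each column of u = Phi G is in the kernel of D and
    Phi u is polynomial, so Psi u = Phi Psi G = Phi L is in H^2 by [Psi_VH]. *)
Lemma Phi_VH_of_kernel (F G L M : 'M[{poly C}]_n) :
  aeT (fun z => Psi z *m evmx F z = evmx G z) -> aeT (fun z => Psi z *m evmx G z = evmx L z) ->
  aeT (fun z => Phi z *m (Phi z *m evmx G z) = evmx M z) -> VH (fun z => Phi z *m evmx L z).
Proof.
move=> h1 h2 h3.
suff hc j : VH (mulmxf Phi (evmx (col j L))).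
  move=> i j; have := hc j i 0; congr (Hp _ _); apply/funext => z.
  by rewrite /mulmxf !mxE; apply: eq_bigr => k _; rewrite !mxE.
have [ku kD] := kernel_poly (col_ae j h1) (col_ae j h2).
set u := mulmxf Phi (evmx (col j G)) in ku kD.
have kPu : VH (mulmxf Phi u).
  apply: (VH_ae (VH_evmx (col j M))); first exact: (V2_meas (V2M bPhi (VH_V2 ku))).
  apply: aeTS h3 => t /matrixP e; apply/matrixP => i k.
  have := e i j; rewrite /u /mulmxf !mxE => <-; apply: eq_bigr => l _; congr (_ * _).
  by rewrite !mxE; apply: eq_bigr => l' _; rewrite !mxE.
have kSu := Psi_VH PsiE bPhi T_proj S_proj PhiN ku kPu (kD u ku).
apply: (VH_ae kSu); first by apply/V2_meas/V2M => //; exact/VH_V2/VH_evmx.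
apply: aeTS (aeTI PhiN (col_ae j h2)) => t [hN e].
by rewrite /u /mulmxf -e mulmxA -hN mulmxA.
Qed.

Variables (s : {poly C}) (Y : 'M[{poly C}]_n).
Hypothesis repPsi : circ_rep Psi s Y.
Variables (mlt : nat) (e0 : {poly C}) (Z : 'M[{poly C}]_n).
Hypothesis mlt_gt0 : (0 < mlt)%N.
Hypothesis e0a : e0.[a] != 0.
Hypothesis ZE : aeT (fun z => (e0 * x ^+ mlt).[z] *: Phi z = evmx Z z).
Hypothesis detZa : (\det Z).[a] != 0.

(** det Psi is the conjugate of det Phi, which is nonzero a.e. since det Z is a nonzero
    polynomial. *)
Lemma detY_neq0 : \det Y != 0.
Proof.
have [hs sY] := repPsi; apply/eqP => Y0.
have Z0 : \det Z != 0 by apply: contra detZa => /eqP ->; rewrite horner0.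
suff : (1 : {poly C}) = 0 by move/eqP; rewrite oner_eq0.
apply: poly_ae_eq0; apply: aeTS (aeTI sY (aeTI ZE (aeT_horner_neq0 Z0))) => t [eY [eZ]].
have zero_det m (A : 'M[{poly C}]_m) z : \det (evmx A z) = (\det A).[z] by rewrite /evmx det_map_mx.
rewrite -zero_det -eZ detZ mulf_eq0 negb_or => /andP[_ dP].
have := zero_det _ Y (cis t); rewrite Y0 horner0 -eY detZ => /eqP.
rewrite mulf_eq0 (negbTE (expf_neq0 _ (circle_free_cis t hs))) /= PsiE.
by rewrite det_map_mx det_tr conjC_eq0 (negbTE dP).
Qed.

Lemma sc_form_eq0_of_local : forall f, VH f -> sc_form T S f f = 0.
Proof.
have S1 f := @Phi_VH _ _ _ _ PsiE bPhi _ _ T_proj S_proj D_ge0 PhiN f.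
have [e1 [V [e1a hV]]] := Psi_right_inverse ha mlt_gt0 e0a ZE detZa bPsi repPsi detY_neq0 S1.
have [e [X [ea hX]]] := Psi_pole_le ha mlt_gt0 e0a ZE detZa bPsi repPsi detY_neq0 S1 Phi_VH_of_kernel.
have mltE : (mlt + mlt.-1 = mlt.-1 + mlt)%N by rewrite addnC.
have mltS : x ^+ mlt = x ^+ mlt.-1 * x by rewrite -exprSr prednK.
(* The order 2 mlt - 1 at [a] is one less than the bound 2 mlt on the poles of Phi^2 and Psi Phi, so
   U = Phi G gives simple poles; the residue of Phi U is a nonzero multiple of the invertible
   [evmx (Z *m Z) a]. *)
pose c := e0 ^+ 2 * e * x ^+ (mlt + mlt.-1).
pose F := c *: (x ^+ mlt *: V).
pose G : 'M[{poly C}]_n := (c * e1)%:M.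
pose L := (e0 ^+ 2 * e1 * x ^+ mlt.-1) *: X.
pose U := (e0 * e * e1 * x ^+ mlt.-1) *: Z.
have FG : aeT (fun z => Psi z *m evmx F z = evmx G z).
  apply: aeTS hV => t h; rewrite /F /G evmxZ -scalemxAr h scale_scalar_mx -hornerM.
  by rewrite evmx_scalar.
have GL : aeT (fun z => Psi z *m evmx G z = evmx L z).
  apply: aeTS hX => t h; rewrite /G /L evmxZ -h evmx_scalar mul_mx_scalar scalerA -hornerM.
  by congr (_.[_] *: _); rewrite /c exprD; ring.
have GU : aeT (fun z => Phi z *m evmx G z = evmx U z).
  apply: aeTS ZE => t h; rewrite /G /U evmxZ -h evmx_scalar mul_mx_scalar scalerA -hornerM.
  by congr (_.[_] *: _); rewrite /c exprD; ring.
pose M1 := (e * e1) *: (Z *m Z); pose M2 := (e0 * e1) *: (X *m Z).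
have xE t : cis t - a = x.[cis t] by rewrite hornerXsubC.
apply: (@sc_form_eq0_of_pole _ a ha _ Phi Psi T S U M1 M2) => //.
- apply: aeTS ZE => t h; rewrite /U /M1 !evmxZ evmxM -scalemxAr scalerA xE -hornerM.
  rewrite -[X in _ = _ *: (X *m _)]h -scalemxAl scalerA -hornerM; congr (_.[_] *: _).
  by rewrite mltS; ring.
- apply: aeTS hX => t h; rewrite /U /M2 !evmxZ evmxM -scalemxAr scalerA xE -hornerM.
  rewrite -h -scalemxAl scalerA -hornerM; congr (_.[_] *: _).
  by rewrite mltS; ring.
- rewrite unitmxE unitfE (_ : \det (evmx M1 a) = (\det M1).[a]); last by rewrite /evmx det_map_mx.
  rewrite /M1 detZ det_mulmx hornerM horner_exp !hornerM mulf_neq0 ?expf_neq0 //.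
    by rewrite mulf_neq0.
  by rewrite mulf_neq0.
- move=> j g hg; have [k1 k2] := kernel_poly (col_ae j FG) (col_ae j GL).
  rewrite -(sc_form_ae k1 (VH_evmx _) hg (col_ae j GU)); exact: k2.
Qed.
End Kernel.
End LocalToGlobal.

(** * Blaschke factors and the meaning of coprimeness at a zero of theta *)

Section BlaschkeDivisors.
Context {R : realType}.
Local Notation C := R[i].
Local Notation VH := (mxHp 2%:E).

Definition blaschke_factor (a z : C) : C := (z - a) / (1 - a^*%R * z).

Lemma Hpoo_of (f : C -> C) : cbnd f -> Hp 2%:E f -> Hp +oo%E f.
Proof. by move=> /LpooP h [_ k]; split. Qed.

Lemma cbnd_blaschke_factor a : `|a| < 1 -> cbnd (blaschke_factor a).
Proof.
move=> ha; have ha' : `|a^*%R| < 1 by rewrite norm_conjC.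
by apply: cbndM (cbnd_invout ha'); apply: cbndD cbnd_id (cbnd_cst _).
Qed.

Lemma H2_blaschke_factorM a (f : C -> C) : `|a| < 1 -> Hp 2%:E f -> Hp 2%:E (fun z => blaschke_factor a z * f z).
Proof.
move=> ha hf; have ha' : `|a^*%R| < 1 by rewrite norm_conjC.
by under eq_fun do rewrite /blaschke_factor -mulrA; exact/H2_mul_subr/H2_divout.
Qed.

Lemma blaschke_factor_unit a t : `|a| < 1 -> blaschke_factor a (cis t) * (blaschke_factor a (cis t))^*%R = 1.
Proof.
move=> ha; have ha' : `|a^*%R| < 1 by rewrite norm_conjC.
have h1 := subr_mul_neq0 t ha'; have h0 := cis_neq0 t.
have h2 : cis t - a != 0 by rewrite cis_subr_neq0 // lt_eqF.
have c1 : (cis t - a)^*%R = (1 - a^*%R * cis t) / cis t by rewrite rmorphB /= cisJ; field.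
have c2 : (1 - a^*%R * cis t)^*%R = (cis t - a) / cis t.
  by rewrite rmorphB rmorphM rmorph1 /= conjCK cisJ; field.
rewrite /blaschke_factor rmorphM fmorphV /= c1 c2.
by move: (cis t) h0 (1 - _) h1 (_ - a) h2 => z h0 u h1 v h2; field; rewrite h1 h2 h0.
Qed.

Lemma blaschke_factor_neq0 a t : `|a| < 1 -> blaschke_factor a (cis t) != 0.
Proof. by move=> ha; apply/eqP => h; have /eqP := blaschke_factor_unit t ha; rewrite h mul0r eq_sym oner_eq0. Qed.

(** A constant value k turns into a polynomial identity; at [a] it reads k (1 - |a|^2) = 0, against
    unimodularity. *)
Lemma blaschke_factor_not_cst a (k : C) : `|a| < 1 -> ~ aeT (fun z => blaschke_factor a z = k).
Proof.
move=> ha hk; have ha' : `|a^*%R| < 1 by rewrite norm_conjC.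
have : 'X - a%:P - (k%:P - (k * a^*%R) *: 'X) = 0 :> {poly C}.
  apply: poly_ae_eq0; apply: aeTS hk => t h; rewrite !hornerE.
  have h1 := subr_mul_neq0 t ha'.
  have -> : cis t - a = k * (1 - a^*%R * cis t) by rewrite -h /blaschke_factor mulfVK.
  by ring.
move=> h; have := congr1 (horner^~ a) h.
rewrite /= !hornerE subrr sub0r => /eqP; rewrite oppr_eq0 -mulrA -[X in X - _]mulr1 -mulrBr.
rewrite mulf_eq0 [_ * a]mulrC -normCK subr_eq0 => /orP[/eqP k0|].
  suff /eqP : (1 : {poly C}) = 0 by rewrite oner_eq0.
  by apply: poly_ae_eq0; apply: aeTS hk => t h'; move: (blaschke_factor_neq0 t ha); rewrite h' k0 eqxx.
by rewrite gt_eqF // exprn_ilt1 // normr_ge0.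
Qed.

Lemma blaschke_H2 (c : C) (s : seq C) : {in s, forall b, `|b| < 1} ->
  Hp 2%:E (fun z => c * \prod_(b <- s) blaschke_factor b z).
Proof.
move=> hs; apply: H2Z; elim: s hs => [|b s IHs] hs.
  by under eq_fun do rewrite big_nil; exact: H2_cst.
under eq_fun do rewrite big_cons; apply: H2_blaschke_factorM; first by apply: hs; rewrite mem_head.
by apply: IHs => b' hb'; apply: hs; rewrite inE hb' orbT.
Qed.

Lemma ev_unit_of_coprime n (B : C -> 'M[C]_n) (theta : C -> C) (c : C) (s : seq C) (a : C) :
  VH B -> {in s, forall b, `|b| < 1} ->
  aeT (fun z => theta z = c * \prod_(b <- s) blaschke_factor b z) -> a \in s ->
  left_coprime B (fun z => (theta z)%:M) ->
  \matrix_(i, j) ev (fun z => B z i j) a \in unitmx.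
Proof.
move=> hB hs th as_ cop; have ha := hs a as_; set Ba := \matrix_(i, j) _.
rewrite unitmxE unitfE; apply/det0P => -[u u0 uB].
pose nu := (u *m u^t*) 0 0.
have nuE : nu = \sum_i u 0 i * (u 0 i)^*%R by rewrite /nu mxE; apply: eq_bigr => i _; rewrite !mxE.
have [i0 ui0] : exists i, u 0 i != 0.
  apply/existsP; apply: contraR u0; rewrite negb_exists => /forallP h.
  by apply/eqP/rowP => i; rewrite mxE; apply/eqP; rewrite -[_ == _]negbK.
have nu0 : 0 < nu.
  rewrite nuE (bigD1 i0) //= ltr_pwDl //; first by rewrite -normCK exprn_gt0 ?normr_gt0.
  by apply: sumr_ge0 => i _; rewrite -normCK exprn_ge0.
have nuN : nu != 0 by rewrite gt_eqF.
have uu : u *m u^t* = nu%:M by apply/matrixP => i j; rewrite !ord1 [RHS]mxE eqxx mulr1n.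
pose P : 'M[C]_n := nu^-1 *: (u^t* *m u).
have PP : P *m P = P.
  rewrite /P -scalemxAl -scalemxAr -mulmxA [u *m (_ *m _)]mulmxA uu mul_scalar_mx.
  by rewrite -scalemxAr; congr (_ *: _); rewrite scalerA mulVf // scale1r.
have nuJ : (nu^-1)^*%R = nu^-1 by apply/CrealP; rewrite realV gtr0_real.
have PJ : P^t* = P.
  apply/matrixP => i j; rewrite /P !mxE !big_ord1 !mxE !rmorphM /= nuJ conjCK.
  by rewrite [(u 0 i)^*%R * _]mulrC.
have PB : P *m Ba = 0 by rewrite /P -scalemxAl -mulmxA uB mulmx0 scaler0.
have Pi0 : P i0 i0 != 0.
  by rewrite /P mxE mulf_neq0 ?invr_eq0 // mxE big_ord1 !mxE mulf_neq0 // conjC_eq0.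
clearbody P.
(* If B a is singular, P projects onto a vector of its left kernel and this Blaschke-Potapov
   factor divides both B and theta. *)
pose D z : 'M[C]_n := 1%:M - P + blaschke_factor a z *: P.
(* The matrix 1 - P + w P scales the range of [P] by w and fixes its complement; unitarity of [D]
   and both divisions are instances of this. *)
have DI k (X Z : 'M[C]_(n, k)) (w : C) : (1%:M - P + w *: P) *m ((1%:M - P) *m X + P *m Z) =
    (1%:M - P) *m X + w *: (P *m Z).
  rewrite mulmxDl !mulmxDr.
  have E1 : (1%:M - P) *m ((1%:M - P) *m X) = (1%:M - P) *m X.
    by rewrite mulmxA mulmxBl mul1mx mulmxBr mulmx1 PP subrr subr0.
  have E2 : (1%:M - P) *m (P *m Z) = 0 by rewrite mulmxA mulmxBl mul1mx PP subrr mul0mx.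
  have E3 : w *: P *m ((1%:M - P) *m X) = 0.
    by rewrite mulmxA -scalemxAl mulmxBr mulmx1 PP subrr scaler0 mul0mx.
  by rewrite E1 E2 E3 addr0 add0r -scalemxAl mulmxA PP.
have innD : inner_mx D.
  split.
    move=> i j; apply: Hpoo_of.
      under eq_fun do rewrite !mxE; apply: cbndD (cbnd_cst _) _.
      exact: cbndM (cbnd_blaschke_factor ha) (cbnd_cst _).
    under eq_fun do rewrite !mxE; apply: H2D (H2_cst _) _.
    exact: H2_blaschke_factorM ha (H2_cst _).
  apply: aeTW => t; rewrite /D.
  have -> : (1%:M - P + blaschke_factor a (cis t) *: P)^t* = 1%:M - P + (blaschke_factor a (cis t))^*%R *: P.
    by rewrite linearD linearB linearZ /= trmx1 map_mxD map_mxB map_mxZ map_mx1 PJ.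
  have -> : 1%:M - P + blaschke_factor a (cis t) *: P = (1%:M - P) *m 1%:M + P *m (blaschke_factor a (cis t) *: 1%:M).
    by rewrite mulmx1 -scalemxAr mulmx1.
  rewrite DI mulmx1 -scalemxAr mulmx1 scalerA [_^*%R * _]mulrC blaschke_factor_unit // scale1r.
  by rewrite subrK.
have ha1 : `|a| != 1 by rewrite lt_eqF.
have lB : left_inner_divisor D B.
  (* The cofactor stays in H^2 because P B vanishes at [a], so that [H2_divin] absorbs the factor z
     - a in the denominator. *)
  split=> //; exists (fun z => (1%:M - P) *m B z + P *m ((blaschke_factor a z)^-1 *: B z)).
    apply: VHD.
      move=> i j; under eq_fun do rewrite mxE.
      by apply: H2_sum => l; apply: H2Z.
    move=> i j; have hPB : Hp 2%:E (fun z => (P *m B z) i j).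
      by under eq_fun do rewrite mxE; apply: H2_sum => l; exact: H2Z.
    have e0 : ev (fun z => (P *m B z) i j) a = 0.
      transitivity ((P *m Ba) i j); last by rewrite PB mxE.
      rewrite [RHS]mxE /ev; transitivity (integralT (fun z => \sum_l P i l * (B z l j * (z * (z - a)^-1)))).
        by apply: integralT_ext => t; rewrite mxE mulr_suml; apply: eq_bigr => l _; rewrite -mulrA.
      rewrite (cintg_sum _).2 => [|l]; last by apply: cintgZ; exact: Lp2_cintg (H2_Lp (hB l j)) (cbnd_szego ha).
      by apply: eq_bigr => l _; rewrite integralTZ ?mxE //; exact: Lp2_cintg (H2_Lp (hB l j)) (cbnd_szego ha).
    have := H2_horner (1 - a^*%R *: 'X) (H2_divin ha hPB); rewrite e0.
    congr (Hp _ _); apply/funext => z; rewrite -scalemxAr [RHS]mxE /blaschke_factor invf_div !hornerE.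
    by rewrite subr0.
  apply: aeTW => t; rewrite /D DI -scalemxAr scalerA mulfV ?scale1r ?blaschke_factor_neq0 //.
  by rewrite -mulmxDl subrK mul1mx.
have lT : left_inner_divisor D (fun z => (theta z)%:M).
  pose th1 z := c * \prod_(b <- rem a s) blaschke_factor b z.
  have thE z : c * \prod_(b <- s) blaschke_factor b z = blaschke_factor a z * th1 z.
    by rewrite (perm_big _ (perm_to_rem as_)) big_cons /th1 mulrCA.
  have h1 : Hp 2%:E th1 by apply: blaschke_H2 => b /mem_rem; exact: hs.
  split=> //; exists (fun z => (1%:M - P) *m ((blaschke_factor a z * th1 z)%:M) + P *m ((th1 z)%:M)).
    apply: VHD => i j.
      by under eq_fun do rewrite mul_mx_scalar mxE mulrC; apply/H2Z/H2_blaschke_factorM.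
    by under eq_fun do rewrite mul_mx_scalar mxE mulrC; exact: H2Z.
  apply: aeTS th => t ->; rewrite thE /D DI !mul_mx_scalar scalerA -scalerDr subrK.
  by rewrite scalemx1.
have [U [_ _ hU]] := cop _ D lB lT.
(* A constant [D] would make the Blaschke factor constant, as the diagonal entry [i0], where [P] is
   nonzero, shows. *)
apply: (@blaschke_factor_not_cst a ((U i0 i0 - 1 + P i0 i0) / P i0 i0) ha).
apply: aeTS hU => t /matrixP/(_ i0 i0); rewrite !mxE eqxx mulr1n => <-.
by move: (P i0 i0) Pi0 (blaschke_factor _ _) => p p0 w; field.
Qed.
End BlaschkeDivisors.

Lemma Pmx_VH (R : realType) m n (F : R[i] -> 'M[R[i]]_(m, n)) : mxHp 2%:E (Pmx F).
Proof. by move=> i j; under eq_fun do rewrite mxE /P1; exact: Pn_VH. Qed.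

(** The coanalytic part of Phi is conj(theta) B. On the circle |theta| = 1, and the product of the
    factors z - a is theta times the second polynomial, whence the conjugate of theta disappears;
    c^-1 undoes the constant of theta. *)
Lemma blaschke_clear_poles (R : realType) n (Phi B : R[i] -> 'M[R[i]]_n) (theta : R[i] -> R[i])
    (c : R[i]) (s : seq R[i]) : `|c| = 1 -> {in s, forall a, `|a| < 1} ->
  aeT (fun z => theta z = c * \prod_(a <- s) blaschke_factor a z) ->
  aeT (fun z => minus_part Phi z = (B z)^t* *m (theta z)%:M) ->
  aeT (fun z => (\prod_(a <- s) ('X - a%:P)).[z] *: Phi z =
    (\prod_(a <- s) ('X - a%:P)).[z] *: Pmx Phi z +
    (c^-1 *: \prod_(a <- s) (1 - a^*%R *: 'X)).[z] *: B z).
Proof.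
move=> hc hs th hPhi; apply: aeTS (aeTI th hPhi) => t [eth e].
have c0 : c != 0 by rewrite -normr_eq0 hc oner_eq0.
have E : Phi (cis t) - Pmx Phi (cis t) = (theta (cis t))^*%R *: B (cis t).
  move: e; rewrite /minus_part => /(congr1 (fun X => X^t*)); rewrite trCK => ->.
  by rewrite mul_mx_scalar linearZ map_mxZ /= trCK.
have -> : Phi (cis t) = Pmx Phi (cis t) + (theta (cis t))^*%R *: B (cis t) by rewrite -E addrC subrK.
rewrite scalerDr scalerA; congr (_ + _ *: _).
have thJ : theta (cis t) * (theta (cis t))^*%R = 1.
  rewrite eth rmorphM rmorph_prod /= mulrACA -normCK hc expr1n mul1r -big_split /=.
  by rewrite big_seq big1 // => b bs; rewrite blaschke_factor_unit ?hs.
suff -> : (\prod_(a <- s) ('X - a%:P)).[cis t] =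
    (c^-1 *: \prod_(a <- s) (1 - a^*%R *: 'X)).[cis t] * theta (cis t).
  by rewrite -mulrA thJ mulr1.
rewrite eth hornerZ mulrCA !mulrA mulrV ?unitfE // mul1r !horner_prod mulrC -big_split /=.
rewrite [LHS]big_seq [RHS]big_seq; apply: eq_bigr => b bs.
have hb : `|b^*%R| < 1 by rewrite norm_conjC hs.
rewrite !hornerE /blaschke_factor mulfVK //.
exact: subr_mul_neq0.
Qed.

Theorem theorem4p5 (R : realType) (n : nat) (n_gt0 : (0 < n)%N)
    (Phi B : R[i] -> 'M[R[i]]_n) (theta : R[i] -> R[i])
    (Phi_bounded : mxLp +oo%E Phi) (Phi_rational : rational_mx Phi)
    (B_H2 : mxHp 2%:E B) (theta_blaschke : finite_blaschke theta)
    (Phi_minusE :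
      aeT (fun z => minus_part Phi z = (B z)^t* *m (theta z)%:M))
    (B_Theta_coprime : coprime_mx B (fun z => (theta z)%:M))
    (T_hyponormal : hyponormal (Toeplitz Phi))
    (T2_hyponormal : hyponormal (Toeplitz Phi \o Toeplitz Phi)) :
  normal_op (Toeplitz Phi) \/ mxHp +oo%E Phi.
Proof.
have [c [s [hc hs th]]] := theta_blaschke; have c0 : c != 0 by rewrite -normr_eq0 hc oner_eq0.
have := blaschke_clear_poles hc hs th Phi_minusE.
have := Pmx_VH Phi; move: (Pmx Phi) => PP hP clear.
have [bPhi [s0 [Y0 repPhi]]] := circ_rep_of Phi_bounded Phi_rational.
set N := \prod_(a <- s) ('X - a%:P) in clear; set D2 := _ *: \prod_(a <- s) _ in clear.
have [sE|[a as_]] : s = [::] \/ exists a, a \in s.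
  by case: (s) => [|a s']; [left|right; exists a; rewrite mem_head].
  right=> i j; apply: Hpoo_of; first exact: bPhi.
  apply: (H2_ae (H2D (hP i j) (H2Z c^-1 (B_H2 i j)))); first by case: (bPhi i j).
  apply: aeTS clear => t; rewrite /N /D2 sE !big_nil hornerZ hornerC mulr1 !scale1r => ->.
  by rewrite !mxE.
left; have ha := hs a as_.
pose Psi z := (Phi z)^t*.
have PsiE z : Psi z = (Phi z)^t* by [].
have [s1 [Y1 repPsi]] : exists s1 Y1, circ_rep Psi s1 Y1 := circ_repJ repPhi.
have bPsi : mxbnd Psi := mxbndJ bPhi.
have TP := circ_rep_proj bPhi repPhi; have SP := circ_rep_proj bPsi repPsi.
have hp := adj_pair_TS PsiE bPhi TP SP; have hpp := adj_pair_comp hp hp.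
have D0 := hyponormalP hp T_hyponormal; have Q0 := hyponormalP hpp T2_hyponormal.
have PhiN := normal_of_hyponormal bPhi repPhi PsiE D0.
suff D00 f : mxHp 2%:E f -> sc_form (Toeplitz Phi) (Toeplitz Psi) f f = 0.
  by apply: (normal_opP hp) => f g hf hg; exact: (sc_form_cauchy hp D0 hf hg (D00 f hf)).
have N0 : N != 0 by rewrite monic_neq0 // monic_prod_XsubC.
have [m [r [ra NE]]] := polyXsubC_split a N0.
have Na : N.[a] = 0 by apply/eqP; rewrite -/(root _ _) root_prod_XsubC.
have m0 : (0 < m)%N.
  rewrite lt0n; apply/eqP => m0; move: Na; rewrite NE m0 expr0 mulr1.
  by apply/eqP.
have D2a : D2.[a] != 0.
  rewrite hornerZ mulf_neq0 ?invr_eq0 // horner_prod big_seq prodf_seq_neq0 //.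
  apply/allP => b _; apply/implyP => bs; rewrite !hornerE subr_eq0.
  have hb : `|b^*%R * a| < 1.
    by rewrite normrM norm_conjC mulr_ilt1 ?normr_ge0 //; exact: hs.
  by apply/eqP => h; move: hb; rewrite -h normr1 ltxx.
have [hs0 sY0] := repPhi.
have [k [q [qa s0E]]] := polyXsubC_split a (circle_free_neq0 hs0).
pose H z := N.[z] *: PP z + D2.[z] *: B z.
have hH i j : Hp 2%:E (fun z => H z i j).
  under eq_fun do rewrite /H !mxE.
  by apply: H2D; apply: H2_horner; [exact: hP|exact: B_H2].
(* [s0] may vanish at [a] to an order [k] larger than that of the pole; since N Y0 = s0 H a.e. with
   [H] in H^2, the excess is divisible out. *)
have [Z ZE] : exists Z, N *: Y0 = ('X - a%:P) ^+ k *: Z.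
  apply: evmx_dvd => i j; apply: (dvdp_XsubC_H2 ha (H2_horner q (hH i j))).
  apply: aeTS (aeTI clear sY0) => t [e1 e2].
  rewrite -evmxE evmxZ -e2 scalerA [_ * s0.[_]]mulrC -scalerA e1 mxE -/(H _).
  by rewrite s0E hornerM hmX_horner; ring.
have hZ : aeT (fun z => evmx Z z = q.[z] *: H z).
  apply: aeTS (aeTI clear sY0) => t [e1 e2]; apply: (scalerI (x_neq0 ha t k)).
  rewrite -evmxZ -ZE evmxZ -e2 scalerA [_ * s0.[_]]mulrC -scalerA e1 -/(H _) scalerA -hornerM.
  by rewrite [_ * q]mulrC -s0E.
(* N(a) = 0 removes the analytic part, so Z(a) is a nonzero multiple of B(a), which coprimeness
   makes invertible. *)
have Za : evmx Z a = (q.[a] * D2.[a]) *: \matrix_(i, j) ev (fun z => B z i j) a.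
  apply/matrixP => i j; rewrite evmxE [RHS]mxE [in RHS]mxE -(ev_poly _ ha).
  have hN := H2_horner N (hP i j); have hD := H2_horner D2 (B_H2 i j).
  rewrite (ev_ae ha _ _ (g := fun z => q.[z] * (N.[z] * PP z i j + D2.[z] * B z i j))).
  - rewrite (ev_mul_poly _ ha (H2D hN hD)) (evD ha hN hD).
    by rewrite (ev_mul_poly _ ha (hP i j)) (ev_mul_poly _ ha (B_H2 i j)) Na mul0r add0r mulrA.
  - exact/H2_meas/H2_poly.
  - exact/H2_meas/H2_horner/H2D.
  - by apply: aeTS hZ => t /matrixP/(_ i j); rewrite evmxE !mxE.
have unitB := ev_unit_of_coprime B_H2 hs th as_ B_Theta_coprime.1.
apply: (sc_form_eq0_of_local ha PsiE bPhi TP SP D0 PhiN Q0 repPsi m0 (e0 := q * r) (Z := Z)).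
- by rewrite hornerM mulf_neq0.
- apply: aeTS (aeTI clear hZ) => t [e1 ->].
  by rewrite -mulrA -NE hornerM -scalerA e1.
- have -> : (\det Z).[a] = \det (evmx Z a) by rewrite /evmx det_map_mx.
  by rewrite Za detZ mulf_neq0 // ?expf_neq0 ?mulf_neq0.
Qed.
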